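(* Let $P,q\in\mathbb C(z)$ be rational functions with $P$ non-constant of degree $n$ and $q\not\equiv0$, and let $\gamma\subset\mathbb C$ be a non-closed curve with starting point $a$ and ending point $b$, containing no poles of $P$ or $q$. Let $t\in U\cap U_\infty$ be a point close enough to infinity. Then in a neighbourhood of $t$ the equality $$I_\infty(t)=\frac{1}{2\pi\sqrt{-1}}\frac{1}{P(\infty)-t}\int_\gamma q(z)\,dz+\frac{1}{2\pi\sqrt{-1}}\sum_{i=1}^n\left(\frac{\hat q}{P'}\right)\bigl(P_i^{-1}(t)\bigr)+\frac{1}{2\pi\sqrt{-1}}\sum_{i=1}^n\left(\frac{q}{P'}\right)\bigl(P_i^{-1}(t)\bigr)\Bigl[\mathrm{Log}_{2,i}\bigl(b-P_i^{-1}(t)\bigr)-\mathrm{Log}_{1,i}\bigl(a-P_i^{-1}(t)\bigr)\Bigr]$$ holds.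
   Context: A curve is an oriented piecewise-smooth curve in $\mathbb C$ having only transversal self-intersections. $U_\infty$ is the connected component of $\mathbb{CP}^1\setminus P(\gamma)$ containing $\infty$, and $I_\infty$ is the holomorphic function on $U_\infty$ given by $I_\infty(t)=\frac{1}{2\pi\sqrt{-1}}\int_\gamma\frac{q(z)\,dz}{P(z)-t}$. $C_P\subset\mathbb{CP}^1$ is the set of branch points of the algebraic function $P^{-1}$; $U\subset\mathbb C$ is a fixed simply connected domain with $U\cap C_P=\emptyset$ and $\infty\in\partial U$; $P_1^{-1},\dots,P_n^{-1}$ are the single-valued analytic branches of $P^{-1}$ in $U$. $\hat q(t)=\int_\gamma\frac{q(z)-q(t)}{z-t}\,dz$, which is a rational function of $t$ whose poles are among the poles of $q$. For $t\in U\cap U_\infty$, $\mathrm{Log}_{1,i}(z-P_i^{-1}(t))$ denotes a branch of the logarithm defined for $z$ in a neighbourhood of $a$, and $\mathrm{Log}_{2,i}(z-P_i^{-1}(t))$ denotes its analytic continuation in $z$ along $\gamma$ to a neighbourhood of $b$. If $P(\infty)=\infty$, the term containing $\frac{1}{P(\infty)-t}$ is understood to be $0$. *)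

(* Defs.v *)
From HB Require Import structures.
From mathcomp Require Import all_boot all_order all_algebra complex.
From mathcomp Require Import all_classical all_reals all_analysis.
Set Implicit Arguments.
Unset Strict Implicit.
Unset Printing Implicit Defensive.
Import Order.TTheory GRing.Theory Num.Theory.
Import numFieldNormedType.Exports.
Local Open Scope classical_set_scope.
Local Open Scope ring_scope.
Local Open Scope complex_scope.

(* Real-valued parts, not the [C]-valued ones of ssrnum. *)
Local Notation Re := complex.Re.
Local Notation Im := complex.Im.

(* R[i] itself carries no canonical topology; seen as a [numClosedFieldType]
   it gets the one defined by its norm. *)
Definition C (R : realType) : numClosedFieldType := R[i].

(* The Riemann sphere, with [None] the point at infinity. *)
Notation CP1 R := (one_point_compactification (C R)).

Section Sphere.
Variable R : realType.
Implicit Types (z : C R) (x : CP1 R).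

(* Junk value 0 at infinity. *)
Definition finpart x : C R := if x is Some z then z else 0.

Definition CP1_inv x : CP1 R :=
  if x is Some z then (if z == 0 then None else Some z^-1) else Some 0.

Definition boundary (T : topologicalType) (A : set T) : set T :=
  closure A `\` A°.

Definition analytic_at (f : C R -> C R) z0 :=
  exists c : nat -> C R, \forall z \near z0,
    series (fun k => c k * (z - z0) ^+ k) @ \oo --> f z.

(* Analyticity of a sphere-valued map, read in the chart z around finite
   values and in the chart 1/z around infinity. *)
Definition CP1_analytic_at (f : C R -> CP1 R) z0 :=
  {for z0, continuous f} /\
  if f z0 is Some _ then analytic_at (finpart \o f) z0
  else analytic_at (finpart \o CP1_inv \o f) z0.

End Sphere.

Section RationalFunctions.
Variable R : realType.
Implicit Types (f : {fraction {poly C R}}) (z : C R) (x : CP1 R).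

(* Coprime numerator and denominator; they are determined up to a common
   nonzero constant factor, on which nothing below depends. *)
Definition ratnum f : {poly C R} :=
  let: (a, b) := frac (repr f) in a %/ gcdp a b.
Definition ratden f : {poly C R} :=
  let: (a, b) := frac (repr f) in b %/ gcdp a b.

Definition ratdeg f : nat := (maxn (size (ratnum f)) (size (ratden f))).-1.

Definition ratpole f z : bool := root (ratden f) z.

(* The value at a finite point that is not a pole (junk at the poles). *)
Definition rateval f z : C R := (ratnum f).[z] / (ratden f).[z].

(* The induced self-map of the sphere. *)
Definition ratmap f x : CP1 R :=
  match x with
  | Some z => if ratpole f z then None else Some (rateval f z)
  | None => if (size (ratden f) < size (ratnum f))%N then None
            else Some ((ratnum f)`_(size (ratden f)).-1 / lead_coef (ratden f))
  end.

(* The polynomial whose roots are the finite points of the fibre over [y]. *)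
Definition fibre_poly f (y : CP1 R) : {poly C R} :=
  if y is Some w then ratnum f - w *: ratden f else ratden f.

(* The local degree of the map at [x]; at infinity it is the number of
   roots that [fibre_poly] misses. *)
Definition multiplicity f x : nat :=
  let p := fibre_poly f (ratmap f x) in
  if x is Some z then mup z p else (ratdeg f - (size p).-1)%N.

(* The branch points of the inverse algebraic function: the images of the
   points at which f is ramified. *)
Definition branch_points f : set (CP1 R) :=
  [set y | exists2 x, ratmap f x = y & (1 < multiplicity f x)%N].

End RationalFunctions.

Section Domains.
Variable R : realType.
Implicit Type U : set (C R).

Definition null_homotopic U (l : R -> C R) :=
  exists H : R * R -> C R,
    [/\ {within `[0, 1] `*` `[0, 1], continuous H},
        (forall u s, u \in `[0, 1] -> s \in `[0, 1] -> U (H (u, s))),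
        (forall s, s \in `[0, 1] -> H (0, s) = l s),
        (forall s, s \in `[0, 1] -> H (1, s) = l 0) &
        (forall u, u \in `[0, 1] -> H (u, 0) = l 0 /\ H (u, 1) = l 0)].

Definition simply_connected_domain U :=
  [/\ open U, U !=set0, connected U &
      forall l : R -> C R, {within `[0, 1], continuous l} ->
        (forall s, s \in `[0, 1] -> U (l s)) -> l 0 = l 1 ->
        null_homotopic U l].

End Domains.

Section Curves.
Variable R : realType.
Implicit Type g : R -> C R.

(* Curves are parametrized by [0, 1]; values outside are irrelevant. *)

(* The velocity of [g] extends to a continuous nowhere vanishing function on
   the closed interval. *)
Definition smooth_on g (x y : R) :=
  exists v : R -> C R,
    [/\ {within `[x, y], continuous v},
        (forall s, s \in `[x, y] -> v s != 0) &
        (forall s, s \in `]x, y[ ->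
           is_derive s 1 (fun r => Re (g r)) (Re (v s)) /\
           is_derive s 1 (fun r => Im (g r)) (Im (v s)))].

Definition piecewise_smooth g :=
  {within `[0, 1], continuous g} /\
  exists2 s : seq R, itv_partition 0 1 s &
    forall j, (j < size s)%N -> smooth_on g (nth 0 (0 :: s) j) (nth 0 s j).

(* One-sided tangent vectors: one at a smooth interior point, two at a corner. *)
Definition tangent_at g (s : R) (v : C R) :=
  (0 <= s < 1 /\ ((g (s + h) - g s) / h%:C : C R) @[h --> 0^'+] --> v) \/
  (0 < s <= 1 /\ ((g (s + h) - g s) / h%:C : C R) @[h --> 0^'-] --> v).

(* [Im (v^* * w) != 0] says that v and w are linearly independent over R. *)
Definition transversal g :=
  forall s r, 0 <= s -> s < r -> r <= 1 -> (s, r) <> (0, 1) -> g s = g r ->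
    forall v w : C R, tangent_at g s v -> tangent_at g r w ->
      Im (v^* * w) != 0.

Definition curve g := piecewise_smooth g /\ transversal g.

Definition trace g : set (C R) := g @` `[0, 1].

(* Meaningful off the finitely many breakpoints. *)
Definition velocity g (s : R) : C R :=
  derive1 (fun r => Re (g r)) s +i* derive1 (fun r => Im (g r)) s.

Definition curve_integral g (f : C R -> C R) : C R :=
  Rintegral lebesgue_measure `[0, 1] (fun s => Re (f (g s) * velocity g s)) +i*
  Rintegral lebesgue_measure `[0, 1] (fun s => Im (f (g s) * velocity g s)).

(* The germ of [f2] at [g 1] is the analytic continuation along [g] of the
   germ of [f1] at [g 0]. *)
Definition continuation_along g (f1 f2 : C R -> C R) :=
  exists F : R -> C R -> C R,
    [/\ (forall s, s \in `[0, 1] -> analytic_at (F s) (g s)),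
        (forall s : R, s \in `[0, 1] -> \forall r \near s, r \in `[0, 1] ->
           \forall z \near g r, F r z = F s z),
        (\forall z \near g 0, F 0 z = f1 z) &
        (\forall z \near g 1, F 1 z = f2 z)].

End Curves.

Section Logarithm.
Variable R : realType.

Definition cexp (z : C R) : C R :=
  (expR (Re z))%:C * (cos (Im z) +i* sin (Im z)).

Definition log_branch_at (L : C R -> C R) (w0 : C R) :=
  analytic_at L w0 /\ \forall w \near w0, cexp (L w) = w.

End Logarithm.

Section CauchyIntegral.
Variables (R : realType) (P q : {fraction {poly C R}}) (g : R -> C R).

Definition two_pi_i : C R := 0 +i* (2 * pi).

Definition U_infty : set (CP1 R) :=
  connected_component (~` (ratmap P @` (Some @` trace g))) None.

Definition I_infty (t : C R) : C R :=
  two_pi_i^-1 * curve_integral g (fun z => rateval q z / (rateval P z - t)).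

(* Meaningful when [t] is not a pole of [q]. *)
Definition qhat (t : C R) : C R :=
  curve_integral g (fun z => (rateval q z - rateval q t) / (z - t)).

(* 1 / (P(infty) - t), understood to be 0 when P(infty) = infty. *)
Definition inv_at_infty (t : C R) : C R :=
  if ratmap P None is Some c then (c - t)^-1 else 0.

(* [B] lists the [n] single-valued analytic branches of the inverse of [P]
   in [U]; a branch takes the value infinity at P(infty) if that lies in [U]. *)
Definition inverse_branches (n : nat) (U : set (C R))
    (B : 'I_n -> C R -> CP1 R) :=
  [/\ (forall i t, U t -> CP1_analytic_at (B i) t),
      (forall i t, U t -> ratmap P (B i t) = Some t) &
      (forall i j, i != j -> exists2 t, U t & B i t <> B j t)].

(* For every [t] in [U] with [Some t] in U_infty, [L1 i t] is a branch of the
   logarithm near a - P_i^-1(t) and [L2 i t] is the branch near b - P_i^-1(t)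
   obtained from it by continuing z |-> L1 i t (z - P_i^-1(t)) along [g]. *)
Definition log_choice (n : nat) (U : set (C R)) (B : 'I_n -> C R -> CP1 R)
    (L1 L2 : 'I_n -> C R -> C R -> C R) :=
  forall i t c, U t -> U_infty (Some t) -> B i t = Some c ->
    log_branch_at (L1 i t) (g 0 - c) /\
    continuation_along g (fun z => L1 i t (z - c)) (fun z => L2 i t (z - c)).

End CauchyIntegral.

(* Main.v *)
Require Import Defs.
From HB Require Import structures.
From mathcomp Require Import all_boot all_order all_algebra complex.
From mathcomp Require Import all_classical all_reals all_analysis.
From mathcomp Require Import measurable_realfun zify ring lra.
Import Order.TTheory GRing.Theory Num.Theory.
Import numFieldNormedType.Exports.
Local Open Scope classical_set_scope.
Local Open Scope ring_scope.
Local Open Scope complex_scope.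
Set Implicit Arguments.
Unset Strict Implicit.
Unset Printing Implicit Defensive.

(* For s off P(gamma) and different from P(infinity), the fibre of P over s
   consists of n distinct simple finite points c_i = P_i^-1(s), so partial
   fractions give
     1/(P(z) - s) = 1/(P(infinity) - s) + sum_i 1/(P'(c_i) (z - c_i)).
   Multiplying by q(z) = (q(z) - q(c_i)) + q(c_i) and integrating along gamma
   reduces the formula to int_gamma dz/(z - c_i) = Log_2 - Log_1.  For the
   latter, the values of the continued branch along gamma form a continuous
   lift of log(gamma - c_i), which is differentiable on the smooth pieces; that
   the continued germs remain logarithms is the identity theorem, used only in
   the form: zeros of a power series do not accumulate at its centre.
   The points P_i^-1(s) are distinct for every s in U because the set where two
   branches agree is open (P is locally injective off the branch points) and
   closed in the connected set U. *)

Local Notation Re := complex.Re.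
Local Notation Im := complex.Im.

(** * Power series *)

Section PowerSeries.
Context {K : numFieldType}.
Implicit Types (c : nat -> K) (w z : K).

Lemma near_dist_le z0 (e : K) : 0 < e -> \forall z \near z0, `|z - z0| <= e.
Proof.
move=> e0; apply/nbhs_ballP; exists e => //= z.
by rewrite -ball_normE /ball_ /= distrC => /ltW.
Qed.

Lemma sum_geometric_half (r : K) n : 0 <= r <= 2^-1 ->
  \sum_(0 <= i < n) r ^+ i <= 2.
Proof.
move=> /andP[r0 r1].
(* The extra summand makes the bound inductive: [2 * r <= 1] gives
   [r ^+ n + 2 * r ^+ n.+1 <= 2 * r ^+ n]. *)
suff : \sum_(0 <= i < n) r ^+ i + 2 * r ^+ n <= 2.
  by apply: le_trans; rewrite lerDl mulr_ge0 ?exprn_ge0.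
elim: n => [|n IH]; first by rewrite big_nil add0r expr0 mulr1.
rewrite big_nat_recr //=; apply: le_trans IH.
rewrite -addrA lerD2l [leRHS]mulrDl mul1r lerD2l exprS mulrA.
rewrite ler_piMl ?exprn_ge0//.
by rewrite mulrC -ler_pdivlMr// mul1r.
Qed.

(* The leading term dominates: the remaining terms are bounded by a geometric
   series, the coefficients being O(|w1|^-m) since the series converges at w1. *)
Lemma power_series_leading_term c w1 : w1 != 0 ->
  cvgn (series (fun k => c k * w1 ^+ k)) ->
  exists2 A : K, 0 <= A & forall k w (h : K),
    (forall m, (m < k)%N -> c m = 0) -> `|w| <= `|w1| / 2 ->
    series (fun m => c m * w ^+ m) @ \oo --> h ->
    `|h - c k * w ^+ k| <= A * (`|w| / `|w1|) ^+ k.+1.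
Proof.
move=> w10 /cvg_series_cvg_0 c0.
(* [A] bounds the terms [c k * w1 ^+ k], which tend to 0 by convergence at [w1]. *)
have /cvg_seq_bounded/pinfty_ex_gt0[A /ltW A0 /= hA] :
    cvgn (fun k => c k * w1 ^+ k) by apply/cvg_ex; exists 0.
exists (A * 2); first by rewrite mulr_ge0.
move=> k w h ck ww1 ch; apply/ler_addgt0Pr => e e0.
set r := _ / _; have r0 : 0 <= r by rewrite divr_ge0.
have r1 : r <= 2^-1 by rewrite ler_pdivrMr ?normr_gt0// mulrC.
(* The limit [h] is replaced by a partial sum within [e] of it, long enough to contain the term of
   index [k]. *)
move/cvgrPdist_le : ch => /(_ e e0)[N _ /(_ (maxn N k.+1) (leq_maxl _ _)) /= hN].
set S := series _ _ in hN.
have -> : h - c k * w ^+ k = (S - c k * w ^+ k) + (h - S) by ring.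
apply: le_trans (ler_normD _ _) _; rewrite lerD// /S seriesEnat /=.
rewrite (big_cat_nat (n := k.+1)) ?leq_maxr//= big_nat_recr//=.
rewrite big_nat_cond big1 ?add0r; last first.
  by move=> m; rewrite andbT => /andP[_ /ck ->]; rewrite mul0r.
rewrite addrAC subrr add0r; apply: le_trans (ler_norm_sum _ _ _) _.
rewrite -{1}[k.+1]add0n big_addn.
have tm m : `|c (m + k.+1)%N * w ^+ (m + k.+1)| <= A * r ^+ k.+1 * r ^+ m.
  rewrite -mulrA -exprD [(_ + m)%N]addnC normrM normrX /r expr_div_n mulrA.
  have wp : 0 < `|w1| ^+ (m + k.+1) by rewrite exprn_gt0 ?normr_gt0.
  rewrite ler_pdivlMr// mulrAC ler_wpM2r ?exprn_ge0//.
  by rewrite -normrX -normrM; exact: hA.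
apply: le_trans (ler_sum _ (fun m _ => tm m)) _.
rewrite -mulr_sumr [leRHS]mulrAC ler_wpM2l ?mulr_ge0 ?exprn_ge0//.
by apply: sum_geometric_half; rewrite r0.
Qed.

Lemma power_series_near c (f : K -> K) z0 k :
  (\forall z \near z0, series (fun m => c m * (z - z0) ^+ m) @ \oo --> f z) ->
  (forall m, (m < k)%N -> c m = 0) ->
  exists2 A : K, 0 <= A &
    \forall z \near z0, `|f z - c k * (z - z0) ^+ k| <= A * `|z - z0| ^+ k.+1.
Proof.
move=> fc ck; have /nbhs_ballP[d /= d0 dfc] := fc.
(* Half the radius [d] is a nonzero displacement at which the series still converges. *)
have w10 : d / 2 != 0 by rewrite gt_eqF ?divr_gt0.
have [|A A0 hA] := @power_series_leading_term c _ w10.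
  apply/cvg_ex; exists (f (z0 + d / 2)).
  have := dfc (z0 + d / 2); rewrite addrAC subrr add0r; apply.
  rewrite -ball_normE /ball_ /= opprD addrA subrr add0r normrN gtr0_norm ?divr_gt0//.
  by rewrite ltr_pdivrMr// ltr_pMr// ltr1n.
exists (A / `|d / 2| ^+ k.+1); first by rewrite divr_ge0.
near=> z.
have := hA k (z - z0) (f z) ck; rewrite expr_div_n mulrA mulrAC; apply.
  by near: z; apply: near_dist_le; rewrite divr_gt0// normr_gt0.
by near: z.
Unshelve. all: by end_near. Qed.

(** Case [k = 0] of the leading-term estimate; evaluating it at [z0] identifies [c 0] with
    [f z0]. *)
Lemma power_series_continuous c (f : K -> K) z0 :
  (\forall z \near z0, series (fun m => c m * (z - z0) ^+ m) @ \oo --> f z) ->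
  f z @[z --> z0] --> f z0.
Proof.
move=> fc; have [//|A A0 hA] := power_series_near fc (k := 0%N).
have fz0 : c 0%N = f z0.
  have := nbhs_singleton hA.
  by rewrite subrr normr0 expr1 mulr0 expr0 mulr1 normr_le0 subr_eq0 => /eqP.
(* [A + 1] can be divided by even when [A] is 0. *)
have A1 : 0 < A + 1 by rewrite ltr_wpDl.
apply: (iffRL (cvgrPdist_le (F := nbhs z0) _ _)) => e e0; near=> z.
have : `|f z - c 0%N * (z - z0) ^+ 0| <= A * `|z - z0| ^+ 1 by near: z.
rewrite expr0 mulr1 fz0 distrC expr1 => /le_trans; apply.
apply: (@le_trans _ _ ((A + 1) * `|z - z0|)).
  by rewrite ler_wpM2r// lerDl.
rewrite mulrC -ler_pdivlMr//; near: z.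
by apply: near_dist_le; rewrite divr_gt0.
Unshelve. all: by end_near. Qed.

(** Strong induction on [k] kills every coefficient: at a zero [z != z0] the estimate reads |c_k| <=
    A |z - z0|, and such zeros exist arbitrarily close to [z0]. *)
Lemma power_series_isolated_zeros c (f : K -> K) z0 :
  (\forall z \near z0, series (fun m => c m * (z - z0) ^+ m) @ \oo --> f z) ->
  (forall A, nbhs z0 A -> exists z, [/\ A z, z != z0 & f z = 0]) ->
  \forall z \near z0, f z = 0.
Proof.
move=> fc hf.
have c0 k : c k = 0.
  elim/ltn_ind: k => k ck; have [A A0 hA] := power_series_near fc ck.
  have A1 : 0 < A + 1 by rewrite ltr_wpDl.
  apply/eqP; rewrite -normr_le0; apply/ler_addgt0Pr => e e0; rewrite add0r.
  have ne : \forall z \near z0, `|z - z0| <= e / (A + 1).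
    by apply: near_dist_le; rewrite divr_gt0.
  have [z [[hz ze] zz0 fz]] := hf _ (filterI hA ne).
  move: hz; rewrite fz sub0r normrN normrM normrX exprS mulrA.
  rewrite ler_pM2r ?exprn_gt0 ?normr_gt0 ?subr_eq0// => /le_trans; apply.
  apply: (@le_trans _ _ ((A + 1) * `|z - z0|)).
    by rewrite ler_wpM2r// lerDl.
  by rewrite mulrC -ler_pdivlMr.
apply: filterS fc => z.
have -> : (fun k => c k * (z - z0) ^+ k) = (fun=> 0).
  by apply/funext => k; rewrite c0 mul0r.
have -> : series (fun=> 0 : K) = (fun=> 0).
  by apply/funext => n; rewrite seriesEnat /= big1.
by move=> h; apply/esym/(cvg_unique _ (cvg_cst _) h).
Qed.

Lemma power_seriesB c b (f h : K -> K) z0 :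
  (\forall z \near z0, series (fun m => c m * (z - z0) ^+ m) @ \oo --> f z) ->
  (\forall z \near z0, series (fun m => b m * (z - z0) ^+ m) @ \oo --> h z) ->
  \forall z \near z0,
    series (fun m => (c m - b m) * (z - z0) ^+ m) @ \oo --> f z - h z.
Proof.
apply: filterS2 => z fz hz.
suff -> : series (fun m => (c m - b m) * (z - z0) ^+ m)
    = series (fun k => c k * (z - z0) ^+ k) - series (fun k => b k * (z - z0) ^+ k).
  exact: cvgB.
apply/funext => n; rewrite /series /= -[RHS]sumrB.
by apply: eq_bigr => k _; rewrite mulrBl.
Qed.

Lemma power_series_affine c (f : K -> K) a b z0 :
  (\forall z \near a * z0 + b,
    series (fun m => c m * (z - (a * z0 + b)) ^+ m) @ \oo --> f z) ->
  \forall z \near z0,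
    series (fun m => c m * a ^+ m * (z - z0) ^+ m) @ \oo --> f (a * z + b).
Proof.
move=> fc; have ca : a * z + b @[z --> z0] --> a * z0 + b.
  apply: (cvgD (F := nbhs z0)); last exact: cvg_cst.
  by apply: (cvgM (F := nbhs z0)); [exact: cvg_cst|exact: cvg_id].
have := ca _ fc; rewrite /fmap /=; apply: (filterS (F := nbhs z0)) => z /=.
suff -> : (fun m => c m * a ^+ m * (z - z0) ^+ m) =
  (fun m => c m * (a * z + b - (a * z0 + b)) ^+ m) by [].
apply/funext => m; rewrite (_ : a * z + b - _ = a * (z - z0)); last by ring.
by rewrite exprMn mulrA.
Qed.

Lemma power_series_cst a z0 :
  \forall z \near z0,
    series (fun m => (if m is 0 then a else 0) * (z - z0) ^+ m) @ \oo --> a.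
Proof.
apply: (nearW (F := nbhs z0)) => z; apply: cvg_near_cst; exists 1%N => // n /= n0.
rewrite seriesEnat /= big_ltn// expr0 mulr1 big_nat_cond big1 ?addr0//.
by case=> //= k _; rewrite mul0r.
Qed.

End PowerSeries.

Section AnalyticFunctions.
Context {R : realType}.
Implicit Types (f h : C R -> C R) (z a b : C R).

Lemma analytic_at_continuous f z0 : analytic_at f z0 -> f z @[z --> z0] --> f z0.
Proof. by move=> [c /power_series_continuous]. Qed.

Lemma analytic_at_isolated_zeros f z0 : analytic_at f z0 ->
  (forall A, nbhs z0 A -> exists z, [/\ A z, z != z0 & f z = 0]) ->
  \forall z \near z0, f z = 0.
Proof. by move=> [c /power_series_isolated_zeros]. Qed.

Lemma analytic_atB f h z0 : analytic_at f z0 -> analytic_at h z0 ->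
  analytic_at (fun z => f z - h z) z0.
Proof.
move=> [c fc] [b hb]; exists (fun k => c k - b k).
exact (@power_seriesB (C R) c b f h z0 fc hb).
Qed.

Lemma analytic_at_affine f a b z0 :
  analytic_at f (a * z0 + b) -> analytic_at (fun z => f (a * z + b)) z0.
Proof.
move=> [c fc]; exists (fun k => c k * a ^+ k).
exact (@power_series_affine (C R) c f a b z0 fc).
Qed.

Lemma analytic_at_cst a z0 : analytic_at (fun=> a) z0.
Proof.
by exists (fun k => if k is 0%N then a else 0); exact (@power_series_cst (C R) a z0).
Qed.

End AnalyticFunctions.

(** * The complex exponential and continuous logarithms *)

Section ComplexTopology.
Context {R : realType}.
Implicit Types z w : C R.

Lemma normc_real (x : R) : `|x%:C| = `|x|%:C :> C R.
Proof. by rewrite [LHS]normc_def /= expr0n/= addr0 sqrtr_sqr. Qed.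

Lemma normc_imag (x : R) : `|0 +i* x : C R| = `|x|%:C :> C R.
Proof. by rewrite [LHS]normc_def /= expr0n/= add0r sqrtr_sqr. Qed.

Lemma normc_ge_Im z : `|Im z|%:C <= `|z| :> C R.
Proof.
have := @normc_ge_Re R (z * 'i%C).
by rewrite ReiNIm normrN normrM [X in _ * X]normc_imag normr1 mulr1.
Qed.

Section Cvg.
Context {T : Type} {F : set_system T} {FF : Filter F}.
Implicit Types f : T -> C R.

Lemma Re_cvg f (l : C R) : f @ F --> l -> Re (f x) @[x --> F] --> Re l.
Proof.
move=> /cvgrPdist_lt fl; apply/cvgrPdist_lt => e e0.
have e0C : 0 < e%:C :> C R by rewrite ltcR.
apply: filterS (fl _ e0C) => x; rewrite -ltcR; apply: le_lt_trans.
by have := @normc_ge_Re R (l - f x); rewrite raddfB.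
Qed.

Lemma Im_cvg f (l : C R) : f @ F --> l -> Im (f x) @[x --> F] --> Im l.
Proof.
move=> /cvgrPdist_lt fl; apply/cvgrPdist_lt => e e0.
have e0C : 0 < e%:C :> C R by rewrite ltcR.
apply: filterS (fl _ e0C) => x; rewrite -ltcR; apply: le_lt_trans.
by have := normc_ge_Im (l - f x); rewrite raddfB.
Qed.

Lemma complex_cvg (a b : T -> R) x y : a @ F --> x -> b @ F --> y ->
  (a t +i* b t : C R) @[t --> F] --> (x +i* y : C R).
Proof.
move=> /cvgrPdist_lt ax /cvgrPdist_lt bx; apply/cvgrPdist_lt => e e0.
(* A positive element of [C R] has zero imaginary part, so [e] is twice a positive real. *)
have [r r0 ->] : exists2 r : R, 0 < r & e = r%:C + r%:C.
  move: e0; case: e => e i; rewrite ltcE /= => /andP[/eqP -> e0].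
  by exists (e / 2); rewrite ?divr_gt0//; simpc; rewrite -splitr.
apply: filterS2 (ax _ r0) (bx _ r0) => t; rewrite -!ltcR => ha hb.
have -> : (x +i* y : C R) - (a t +i* b t) = (x - a t)%:C + (0 +i* (y - b t)).
  by simpc.
apply: le_lt_trans (ler_normD _ _) _.
by apply: ltrD; rewrite ?normc_real ?normc_imag.
Qed.
End Cvg.

Lemma cexpD z w : cexp (z + w) = cexp z * cexp w.
Proof.
case: z w => [a b] [c d]; rewrite /cexp /= expRD cosD sinD; simpc.
by congr (_ +i* _); ring.
Qed.

Lemma normc_cexp z : `|cexp z| = (expR (Re z))%:C :> C R.
Proof.
rewrite /cexp normrM normc_real (ger0_norm (expR_ge0 _)).
rewrite [X in _ * X](_ : _ = 1) ?mulr1//.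
by rewrite [LHS]normc_def /= cos2Dsin2 sqrtr1.
Qed.

Lemma cexp_neq0 z : cexp z != 0.
Proof. by rewrite -normr_gt0 normc_cexp ltcR expR_gt0. Qed.

(** Equal moduli give equal real parts; then the sine of the difference of the imaginary parts is 0,
    and the sine has no other zero than 0 strictly between -pi and pi. *)
Lemma cexp_inj z w : `|Im z - Im w| < pi -> cexp z = cexp w -> z = w.
Proof.
case: z w => [a b] [c d] /= bd zw.
have ac : a = c.
  by have := congr1 Num.norm zw; rewrite !normc_cexp /= => -[] /expR_inj.
have e0 : (expR c)%:C != 0 :> C R by rewrite gt_eqF// ltcR expR_gt0.
move: zw; rewrite ac /cexp /= => /(mulfI e0)[cbd sbd].
have s0 : sin (b - d) = 0 by rewrite sinB cbd sbd mulrC subrr.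
congr (_ +i* _); apply/eqP; rewrite -subr_eq0.
move: bd; rewrite ltr_norml => /andP[bd1 bd2].
have [bd0|bd0|//] := ltrgtP (b - d) 0.
  have := @sin_gt0_pi R (- (b - d)).
  by rewrite sinN s0 oppr0 ltxx oppr_gt0 bd0 ltrNl bd1 => /(_ isT).
by have := @sin_gt0_pi R (b - d); rewrite s0 ltxx bd0 bd2 => /(_ isT).
Qed.

Lemma cexp_cvg {T : Type} {F : set_system T} {FF : Filter F} (f : T -> C R) l :
  f @ F --> l -> cexp (f x) @[x --> F] --> cexp l.
Proof.
move=> fl; rewrite /cexp.
have e : expR (Re (f x)) @[x --> F] --> expR (Re l).
  by apply: continuous_cvg (Re_cvg fl); exact: continuous_expR.
have c : cos (Im (f x)) @[x --> F] --> cos (Im l).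
  by apply: continuous_cvg (Im_cvg fl); exact: continuous_cos.
have s : sin (Im (f x)) @[x --> F] --> sin (Im l).
  by apply: continuous_cvg (Im_cvg fl); exact: continuous_sin.
apply: cvgM; last exact: complex_cvg.
exact: complex_cvg e (cvg_cst _).
Qed.
End ComplexTopology.

(** The clopen argument: inside [A], the set [P] is the trace of an open set and of a closed one,
    both built from interiors of sets defined relative to [A]. *)
Lemma connected_locally_constant {T : topologicalType} (A P : set T) :
  connected A -> (exists2 x, A x & P x) ->
  (forall x, A x -> P x -> \forall y \near x, A y -> P y) ->
  (forall x, A x -> ~ P x -> \forall y \near x, A y -> ~ P y) ->
  A `<=` P.
Proof.
move=> cA [x0 Ax0 Px0] oP cP.
suff <- : A `&` P = A by move=> x [].
apply: cA.
- by exists x0.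
- exists ([set y | A y -> P y]°); first exact: open_interior.
  apply/seteqP; split => x [Ax]; first by move=> Px; split => //; exact: oP.
  by move=> /interior_subset Px; split => //; exact: Px.
- exists (~` [set y | A y -> ~ P y]°); first exact/open_closedC/open_interior.
  apply/seteqP; split => x [Ax].
    by move=> Px; split => // /interior_subset; exact.
  by move=> nx; split => //; apply: contrapT => nPx; apply: nx; exact: cP.
Qed.

Lemma cvg_frequently0 (K : numFieldType) (f : K -> K) (z0 : K) :
  f z @[z --> z0] --> f z0 ->
  (forall A, nbhs z0 A -> exists2 z, A z & f z = 0) -> f z0 = 0.
Proof.
move=> cf h; apply/eqP; apply: contrapT => /negP f0.
have : \forall z \near z0, f z != 0 by exact: (cvgr_neq0 _ cf f0).
by move=> /h[z] /[swap] ->; rewrite eqxx.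
Qed.

Lemma near_subr (K : numFieldType) (P : K -> Prop) (z0 c : K) :
  (\forall w \near z0 - c, P w) -> \forall z \near z0, P (z - c).
Proof.
have cc : z - c @[z --> z0] --> z0 - c.
  by apply: (cvgB (F := nbhs z0)); [exact: cvg_id|exact: cvg_cst].
exact: cc.
Qed.

(** * Continuation of a logarithm along a curve *)

Section LogarithmAlongCurve.
Context {R : realType}.
Implicit Types (f L : C R -> C R) (z w c : C R) (g : R -> C R).

Lemma cexp0 : cexp (0 : C R) = 1.
Proof. by rewrite /cexp /= expR0 cos0 sin0 mul1r. Qed.

Lemma cexpN z : cexp (- z) = (cexp z)^-1.
Proof.
apply: (mulfI (cexp_neq0 z)).
by rewrite -cexpD subrr cexp0 divff// cexp_neq0.
Qed.

(** The branch is L((w0/w1) w) - L(w0) + v. A single branch somewhere thus yields one at each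
    nonzero point, with any prescribed admissible value. *)
Lemma log_branch_transport L w0 w1 v : log_branch_at L w0 -> w1 = cexp v ->
  exists2 l, log_branch_at l w1 & l w1 = v.
Proof.
move=> [aL eL] ev.
have w10 : w1 != 0 by rewrite ev cexp_neq0.
have eL0 := nbhs_singleton eL.
have w00 : w0 != 0 by rewrite -eL0 cexp_neq0.
have w01 : w0 / w1 * w1 + 0 = w0 by rewrite addr0 divfK.
exists (fun w => L (w0 / w1 * w + 0) - (L w0 - v)); last first.
  by rewrite w01 opprB addrCA subrr addr0.
split.
  apply: analytic_atB; last exact: analytic_at_cst.
  by apply: analytic_at_affine; rewrite w01.
have cw : w0 / w1 * w + 0 @[w --> w1] --> w0.
  rewrite -[X in _ --> X]w01.
  apply: (cvgD (F := nbhs w1)); last exact: cvg_cst.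
  by apply: (cvgM (F := nbhs w1)); [exact: cvg_cst|exact: cvg_id].
have := cw _ eL; rewrite /fmap /=; apply: (filterS (F := nbhs w1)) => w /= ew.
rewrite cexpD opprB cexpD cexpN ew eL0 -ev addr0.
by rewrite mulrACA divfK// mulrCA divff// mulr1.
Qed.

(* The logarithm l of z - c with l z0 = f z0 has values close to those of f, so
   f - l vanishes wherever cexp (f z) = z - c near z0. *)
Lemma log_branch_rigid L w0 f z0 c : log_branch_at L w0 -> analytic_at f z0 ->
  (forall A, nbhs z0 A -> exists z, [/\ A z, z != z0 & cexp (f z) = z - c]) ->
  \forall z \near z0, cexp (f z) = z - c.
Proof.
move=> lL af hf.
have cf := analytic_at_continuous af.
(* The relation passes to the limit [z0] by continuity; in particular [z0 - c] is nonzero, so a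
   logarithm [l] exists there. *)
have ez0 : z0 - c = cexp (f z0).
  apply/eqP; rewrite eq_sym -subr_eq0; apply/eqP.
  pose k z := cexp (f z) - (z - c).
  apply: (@cvg_frequently0 _ k).
    apply: (cvgB (F := nbhs z0)); first exact: (cexp_cvg (F := nbhs z0)).
    by apply: (cvgB (F := nbhs z0)); [exact: cvg_id|exact: cvg_cst].
  by move=> A /hf[z [Az _ fz]]; exists z => //; rewrite /k fz subrr.
have [l [al el] l0] := log_branch_transport lL ez0.
have al' : analytic_at (fun z => l (1 * z + - c)) z0.
  by apply: analytic_at_affine; rewrite mul1r.
have cl := analytic_at_continuous al'.
(* With both imaginary parts within pi/2 of their common value at [z0], they differ by less than pi
   and [cexp_inj] applies. *)
have near_pi (h : C R -> C R) : h z @[z --> z0] --> h z0 ->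
    \forall z \near z0, `|Im (h z0) - Im (h z)| < pi / 2.
  move=> /(Im_cvg (F := nbhs z0)) /cvgrPdist_lt; apply.
  by rewrite divr_gt0 ?pi_gt0.
have el' : \forall z \near z0, cexp (l (1 * z + - c)) = z - c.
  have := @near_subr (C R) _ z0 c el; apply: (filterS (F := nbhs z0)) => z.
  by rewrite mul1r.
have zero : \forall z \near z0, f z - l (1 * z + - c) = 0.
  apply: analytic_at_isolated_zeros; first exact: analytic_atB.
  move=> A nA.
  have := hf _ (filterI nA (filterI el' (filterI (near_pi _ cf) (near_pi _ cl)))).
  move=> [z [[Az [elz [fz lz]]] zz0 efz]]; exists z; split => //.
  apply/eqP; rewrite subr_eq0; apply/eqP/cexp_inj; last by rewrite efz elz.
  move: lz; rewrite mul1r l0 => lz.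
  move: fz lz; rewrite mul1r !ltr_norml => /andP[? ?] /andP[? ?].
  by apply/andP; split; lra.
apply: (filterS2 (F := nbhs z0)) zero el' => z /eqP; rewrite subr_eq0 => /eqP ->.
by [].
Qed.

(** The lift sends [s] to [F s (g s)]. Call [s] good if the germ [F s] is a logarithm of [z - c]
    near [g s]; the good parameters contain 0 and are open and closed in [0, 1]. *)
Lemma log_along_curve g L1 L2 c :
  {within `[0, 1], continuous g} -> log_branch_at L1 (g 0 - c) ->
  continuation_along g (fun z => L1 (z - c)) (fun z => L2 (z - c)) ->
  exists phi : R -> C R, [/\ {within `[0, 1], continuous phi},
    forall s, s \in `[0, 1] -> cexp (phi s) = g s - c,
    phi 0 = L1 (g 0 - c) & phi 1 = L2 (g 1 - c)].
Proof.
move=> /subspace_continuousP cg lL1 [F [aF loc F0 F1]].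
have F0' : \forall z \near g 0, cexp (F 0 z) = z - c.
  have := near_subr (proj2 lL1); apply: (filterS2 (F := nbhs (g 0))) F0 => z ->.
  by [].
pose I := `[0, 1]%classic : set R.
have key : I `<=` [set s | \forall z \near g s, cexp (F s z) = z - c].
  apply: connected_locally_constant.
  - exact: segment_connected.
  - by exists 0; [rewrite /I /= in_itv /= lexx ler01|exact: F0'].
  (* Openness: for [r] near [s], the identity for [F s] still holds around [g r], where [F r] agrees
     with [F s]. *)
  - move=> s sI Es; have /= := cg s sI _ (nbhs_interior Es).
    rewrite /within /=; apply: (filterS2 (F := nbhs s)) (loc s sI).
    move=> r hr hg rI; have := hr rI; have := hg rI.
    by apply: (filterS2 (F := nbhs (g r))) => z ez ->.
  (* Closedness: if good parameters [r] accumulate at [s], then [F s] satisfies the identity near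
     each such [g r], and rigidity makes [s] good. *)
  - move=> s sI nEs; apply: contrapT => h; apply: nEs.
    have freq V : nbhs s V -> exists r, [/\ V r, I r &
        \forall z \near g r, cexp (F s z) = z - c].
      move=> sV; apply: contrapT => hV; apply: h.
      apply: (filterS2 (F := nbhs s)) sV (loc s sI) => r Vr hr rI Er.
      apply: hV; exists r; split; [exact: Vr|exact: rI|].
      by apply: (filterS2 (F := nbhs (g r))) (hr rI) Er => z ->.
    (* If g r = g s, both germs are germs at the same point; otherwise the
       points g r accumulate at g s. *)
    have [[r [rI gr Er]]|hn] :=
      pselect (exists r, [/\ I r, g r = g s & \forall z \near g r, cexp (F s z) = z - c]).
      by rewrite /= -gr.
    apply: log_branch_rigid lL1 (aF s sI) _ => A nA.
    have := cg s sI A nA; rewrite /fmap /within /= => /freq[r [Ar rI Er]].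
    exists (g r); split; [exact: Ar| |exact: nbhs_singleton Er].
    by apply/eqP => gr; apply: hn; exists r.
exists (fun s => F s (g s)); split.
(* For [r] near [s] the value [F r (g r)] equals [F s (g r)], a composite of continuous maps. *)
- apply/subspace_continuousP => s sI.
  have h : F s (g r) @[r --> within `[0, 1]%classic (nbhs s)] --> F s (g s).
    exact: (cvg_comp _ _ (cg s sI) (analytic_at_continuous (aF s sI))).
  move=> A /h; rewrite /fmap /within /=.
  apply: (filterS2 (F := nbhs s)) (loc s sI) => r hr hA rI.
  by rewrite /= /from_subspace (nbhs_singleton (hr rI)); exact: hA.
- by move=> s /key/nbhs_singleton.
- exact: nbhs_singleton F0.
- exact: nbhs_singleton F1.
Qed.

End LogarithmAlongCurve.

(** * Integrals along piecewise smooth curves *)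

Section PiecewiseContinuous.
Context {R : realType}.
Notation mu := (@lebesgue_measure R).
Implicit Types (f k F : R -> R) (a b x y : R).

Lemma integrable_itv_oo_cc f x y : mu.-integrable `]x, y[ (EFin \o f) ->
  mu.-integrable `[x, y] (EFin \o f).
Proof.
move=> /integrableP[mf fi].
have mf' := emeasurable_fun_itv_cc mf.
apply/integrableP; split => //.
have mo : measurable_fun `]x, y[ (fun u => `|(EFin \o f) u|)%E.
  exact: measurableT_comp.
have mo' : measurable_fun `[x, y[ (fun u => `|(EFin \o f) u|)%E.
  exact/emeasurable_fun_itv_obnd_cbndP.
by rewrite -integral_itv_bndo_bndc// -integral_itv_obnd_cbnd.
Qed.

Lemma integrable_itv_cat f a x b : a <= x -> x <= b ->
  mu.-integrable `[a, x] (EFin \o f) -> mu.-integrable `[x, b] (EFin \o f) ->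
  mu.-integrable `[a, b] (EFin \o f).
Proof.
move=> ax xb fax fxb.
have fxb' : mu.-integrable `]x, b] (EFin \o f).
  by apply: integrableS fxb => //; apply: subset_itvr; rewrite bnd_simp.
move: fax fxb' => /integrableP[max iax] /integrableP[mxb ixb].
have U : `[a, b]%classic = `[a, x]%classic `|` `]x, b]%classic.
  by apply: itv_bndbnd_setU; rewrite bnd_simp.
have mU : measurable_fun (`[a, x]%classic `|` `]x, b]%classic) (EFin \o f).
  exact/measurable_funU.
have mUn : measurable_fun (`[a, x]%classic `|` `]x, b]%classic)
    (fun u => `|(EFin \o f) u|)%E by exact: measurableT_comp.
apply/integrableP; rewrite U; split => //.
rewrite ge0_integral_setU//=; first exact: lte_add_pinfty.
apply/disj_setPS => u [/=]; rewrite !in_itv/=.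
by move=> /andP[_ ux] /andP[xu _]; move: (lt_le_trans xu ux); rewrite ltxx.
Qed.

Lemma Rintegral_itv_cat f a x b : a <= x -> x <= b ->
  mu.-integrable `[a, x] (EFin \o f) -> mu.-integrable `[x, b] (EFin \o f) ->
  \int[mu]_(u in `[a, b]) f u =
  \int[mu]_(u in `[a, x]) f u + \int[mu]_(u in `[x, b]) f u.
Proof.
move=> ax xb fax fxb; have fab := integrable_itv_cat ax xb fax fxb.
rewrite -[\int[mu]_(u in `[x, b]) _]Rintegral_itv_obnd_cbnd; last first.
  by apply: integrableS fxb => //; apply: subset_itvr; rewrite bnd_simp.
by rewrite -(Rintegral_itvB fab) ?bnd_simp// addrC subrK.
Qed.

(** Only the open interval is constrained, since [velocity] is uncontrolled at the breakpoints of a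
    curve. *)
Definition continuous_piece f x y :=
  exists2 k, {within `[x, y], continuous k} & {in `]x, y[, f =1 k}.

Lemma continuous_piece_integrable f x y :
  continuous_piece f x y -> mu.-integrable `[x, y] (EFin \o f).
Proof.
move=> [k ck fk]; apply: integrable_itv_oo_cc.
apply: (@eq_integrable _ _ _ mu _ _ (EFin \o k)) => //.
  by move=> u; rewrite inE /= => /fk ->.
have ki : mu.-integrable `[x, y] (EFin \o k).
  by apply: continuous_compact_integrable => //; exact: segment_compact.
by apply: integrableS ki => //; exact: subset_itv_oo_cc.
Qed.

(** [f] is exchanged for its continuous companion [k], which alters the integrand at the endpoints
    only; the fundamental theorem then applies to [k]. *)
Lemma continuous_piece_FTC f F x y : x < y -> continuous_piece f x y ->
  {within `[x, y], continuous F} ->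
  (forall u, u \in `]x, y[ -> is_derive u 1 F (f u)) ->
  \int[mu]_(u in `[x, y]) f u = F y - F x.
Proof.
move=> xy pf cF dF; have fi := continuous_piece_integrable pf.
have [k ck fk] := pf.
transitivity (\int[mu]_(u in `[x, y]) k u).
  have ki : mu.-integrable `[x, y] (EFin \o k).
    by apply: continuous_compact_integrable => //; exact: segment_compact.
  have foo (h : R -> R) : mu.-integrable `[x, y] (EFin \o h) ->
      \int[mu]_(u in `[x, y]) h u = \int[mu]_(u in `]x, y[) h u.
    move=> hi; rewrite -Rintegral_itv_bndo_bndc; last first.
      by apply: integrableS hi => //; apply: subset_itvl; rewrite bnd_simp.
    rewrite -Rintegral_itv_obnd_cbnd//.
    by apply: integrableS hi => //; exact: subset_itv_oo_cc.
  by rewrite !foo//; apply: eq_Rintegral => u; rewrite inE /= => /fk.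
rewrite /Rintegral (continuous_FTC2 xy ck (F := F))//.
  move/(continuous_within_itvP _ xy): cF => [_ Fx Fy]; split => // u uxy.
  by have [] := dF _ uxy.
by move=> u uxy; rewrite derive1E -fk//; have [] := dF _ uxy.
Qed.

Lemma piecewise_integrable f a b s : itv_partition a b s ->
  (forall j, (j < size s)%N ->
    continuous_piece f (nth 0 (a :: s) j) (nth 0 s j)) ->
  mu.-integrable `[a, b] (EFin \o f).
Proof.
elim: s a => [|x s IH] a.
  (* An empty partition means that the interval is a single point, whose interior is empty. *)
  move=> /itv_partition_nil -> _; apply: integrable_itv_oo_cc.
  by rewrite set_itv_ge ?bnd_simp ?ltxx//; exact: integrable_set0.
move=> ps pf; have ps' := itv_partition_cons ps.
have [/= /andP[ax _] _] := ps.
apply: (integrable_itv_cat (ltW ax) (itv_partition_le ps')).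
  exact/continuous_piece_integrable/(pf 0%N).
by apply: IH => // j js; exact: (pf j.+1).
Qed.

(** Continuity of [F] across the breakpoints lets the increments over the pieces telescope. *)
Lemma piecewise_FTC f F a b s : itv_partition a b s ->
  (forall j, (j < size s)%N ->
    continuous_piece f (nth 0 (a :: s) j) (nth 0 s j)) ->
  {within `[a, b], continuous F} ->
  (forall j, (j < size s)%N ->
    forall u, u \in `](nth 0 (a :: s) j), (nth 0 s j)[ -> is_derive u 1 F (f u)) ->
  \int[mu]_(u in `[a, b]) f u = F b - F a.
Proof.
elim: s a => [|x s IH] a.
  by move=> /itv_partition_nil -> _ _ _; rewrite set_itv1 Rintegral_set1 subrr.
move=> ps pf cF dF; have ps' := itv_partition_cons ps.
have [/= /andP[ax _] _] := ps.
have xb := itv_partition_le ps'.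
have pf' j (js : (j < size s)%N) := pf j.+1 js.
rewrite (Rintegral_itv_cat (ltW ax) xb); last 2 first.
- exact/continuous_piece_integrable/(pf 0%N).
- exact: piecewise_integrable ps' pf'.
have cF' : {within `[x, b], continuous F}.
  by apply: continuous_subspaceW cF; apply: subset_itvr; rewrite bnd_simp ltW.
have cF0 : {within `[a, x], continuous F}.
  by apply: continuous_subspaceW cF; apply: subset_itvl; rewrite bnd_simp.
rewrite (IH x ps' pf' cF' (fun j js => dF j.+1 js)).
by rewrite (continuous_piece_FTC ax (pf 0%N isT) cF0 (dF 0%N isT)) [LHS]addrC addrA subrK.
Qed.
End PiecewiseContinuous.

(** * Derivatives of the logarithm of the modulus and of the argument *)

Section LogarithmicDerivative.
Context {R : realType}.
Implicit Types (a b X Y : R -> R) (u : R).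

(** Near [u] the function [a] is half the logarithm of X^2 + Y^2. *)
Lemma is_derive_log_modulus a X Y u dX dY :
  (\forall r \near u, expR (a r) ^+ 2 = X r ^+ 2 + Y r ^+ 2) ->
  is_derive u 1 X dX -> is_derive u 1 Y dY ->
  is_derive u 1 a ((X u * dX + Y u * dY) / (X u ^+ 2 + Y u ^+ 2)).
Proof.
move=> eXY iX iY; have eu := nbhs_singleton eXY.
have S0 : 0 < X u * X u + Y u * Y u by rewrite -!expr2 -eu exprn_gt0 ?expR_gt0.
apply: (@near_eq_is_derive _ _ _ (2^-1 \*: (ln (R := R) \o (X * X + Y * Y)))).
  apply: (filterS (F := nbhs u)) eXY => r er.
  transitivity (2^-1 * ln (X r ^+ 2 + Y r ^+ 2)); first by rewrite !expr2.
  by rewrite -er lnXn ?expR_gt0// expRK -(mulr_natl (a r)) mulKf.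
have iS : is_derive u 1 (X * X + Y * Y)
    ((X u *: dX + X u *: dX) + (Y u *: dY + Y u *: dY)).
  by apply: is_deriveD; apply: is_deriveM.
have il : is_derive ((X * X + Y * Y) u) 1 (ln (R := R)) (X u * X u + Y u * Y u)^-1.
  exact: is_derive1_ln.
have := is_deriveZ 2^-1 (is_derive1_comp il iS).
move/trigger_derive; apply.
rewrite /GRing.scale /= -!expr2.
by field; rewrite !expr2 gt_eqF.
Qed.

(* Near u, b r - b u is the arcsine of (Y r * X u - X r * Y u) divided by the
   moduli, which avoids dividing by X u or Y u. *)
Lemma is_derive_argument a b X Y u dX dY da :
  (\forall r \near u, X r = expR (a r) * cos (b r)) ->
  (\forall r \near u, Y r = expR (a r) * sin (b r)) ->
  b r @[r --> u] --> b u ->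
  is_derive u 1 a da -> is_derive u 1 X dX -> is_derive u 1 Y dY ->
  is_derive u 1 b ((X u * dY - Y u * dX) / (X u ^+ 2 + Y u ^+ 2)).
Proof.
move=> eX eY cb ia iX iY.
have eXu := nbhs_singleton eX; have eYu := nbhs_singleton eY.
pose w := (Y * cst (X u) - X * cst (Y u)) * (expR \o (- a - cst (a u))).
have wE r : w r = (Y r * X u - X r * Y u) * expR (- a r - a u) by [].
have wu : w u = 0 by rewrite wE [Y u * _]mulrC subrr mul0r.
have nb : \forall r \near u, `|b u - b r| < pi / 2.
  by move/cvgrPdist_lt : cb; apply; rewrite divr_gt0 ?pi_gt0.
apply: (@near_eq_is_derive _ _ _ (cst (b u) + (asin (R := R) \o w))).
  apply: (filterS3 (F := nbhs u)) eX eY nb => r Xr Yr br.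
  have -> : (cst (b u) + (asin (R := R) \o w)) r = b u + asin (w r) by [].
  have -> : w r = sin (b r - b u).
    rewrite wE Xr Yr eXu eYu sinB expRD !expRN.
    by field; rewrite !gt_eqF ?expR_gt0.
  rewrite sinK; first by rewrite addrC subrK.
  move: br; rewrite distrC ltr_norml in_itv /= => /andP[/ltW -> /ltW ->].
  by [].
(* The derivative [da] of the log-modulus drops out, as its cofactor [Y u * X u - X u * Y u] is
   0. *)
have iw : is_derive u 1 w ((Y u * X u - X u * Y u) *: (expR (- a u - a u) * (- da - 0)) +
    expR (- a u - a u) *: ((Y u *: 0 + X u *: dY) - (X u *: 0 + Y u *: dX))).
  apply: is_deriveM.
  by apply: is_deriveB; apply: is_deriveM.
have ias : is_derive (w u) 1 (asin (R := R)) (Num.sqrt (1 - w u ^+ 2))^-1.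
  by apply: is_derive1_asin; rewrite wu ltrN10 ltr01.
have := is_deriveD (is_derive_cst (b u) u 1) (is_derive1_comp ias iw).
move/trigger_derive; apply.
rewrite wu /GRing.scale /= expr0n subr0 sqrtr1 invr1.
have -> : X u ^+ 2 + Y u ^+ 2 = expR (a u) ^+ 2.
  by rewrite eXu eYu !exprMn -mulrDr cos2Dsin2 mulr1.
rewrite expRD !expRN.
by field; rewrite gt_eqF ?expR_gt0.
Qed.
End LogarithmicDerivative.

Lemma itv_partition_piece {R : realType} (a b : R) s j :
  itv_partition a b s -> (j < size s)%N ->
  [/\ a <= nth 0 (a :: s) j, nth 0 (a :: s) j < nth 0 s j & nth 0 s j <= b].
Proof.
elim: s a j => [//|x s IH] a [|j] ps js.
  have [/= /andP[ax _] _] := ps.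
  by split => //; exact: itv_partition_le (itv_partition_cons ps).
have [/= /andP[ax _] _] := ps.
have [h1 h2 h3] := IH x j (itv_partition_cons ps) js; split => //.
by rewrite (le_trans (ltW ax)).
Qed.

(** * Complex integrals along parametrized curves *)

Section CurveIntegral.
Context {R : realType}.
Notation mu := (@lebesgue_measure R).
Notation I := (`[0, 1]%classic : set R).
Implicit Types (z w c : C R) (g phi : R -> C R) (f : C R -> C R).

Lemma ReM z w : Re (z * w) = Re z * Re w - Im z * Im w.
Proof. by case: z w => [a b] [c d]. Qed.

Lemma ImM z w : Im (z * w) = Re z * Im w + Im z * Re w.
Proof. by case: z w => [a b] [c d]. Qed.

(** Inside the interval the derivatives defining [velocity] exist and are the components of the
    smoothness witness, so [velocity] inherits its continuous extension. *)
Lemma smooth_on_velocity g x y : smooth_on g x y ->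
  exists v, [/\ {within `[x, y], continuous v},
    {in `]x, y[, velocity g =1 v} &
    forall s, s \in `]x, y[ ->
      is_derive s 1 (fun r => Re (g r)) (Re (velocity g s)) /\
      is_derive s 1 (fun r => Im (g r)) (Im (velocity g s))].
Proof.
move=> [v [cv _ dv]]; exists v.
have vE : {in `]x, y[, velocity g =1 v}.
  move=> s /dv[dR dI]; rewrite /velocity !derive1E.
  by rewrite (derive_val (is_derive := dR)) (derive_val (is_derive := dI)); case: (v s).
by split => // s sxy; rewrite vE//; exact: dv.
Qed.

Lemma curve_integrand_piece g phi x y : smooth_on g x y ->
  {within `[x, y], continuous phi} ->
  continuous_piece (fun s => Re (phi s * velocity g s)) x y /\
  continuous_piece (fun s => Im (phi s * velocity g s)) x y.
Proof.
move=> /smooth_on_velocity[v [/subspace_continuousP cv vE _]].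
move=> /subspace_continuousP cphi.
have cphiv s : `[x, y]%classic s ->
    phi r * v r @[r --> within `[x, y]%classic (nbhs s)] --> phi s * v s.
  by move=> sxy; exact: (cvgM (cphi s sxy) (cv s sxy)).
split.
- exists (fun s => Re (phi s * v s)); last by move=> s sxy; rewrite vE.
  by apply/subspace_continuousP => s /cphiv/Re_cvg.
- exists (fun s => Im (phi s * v s)); last by move=> s sxy; rewrite vE.
  by apply/subspace_continuousP => s /cphiv/Im_cvg.
Qed.

Lemma curve_integrable g phi : piecewise_smooth g ->
  {within I, continuous phi} ->
  mu.-integrable I (EFin \o (fun s => Re (phi s * velocity g s))) /\
  mu.-integrable I (EFin \o (fun s => Im (phi s * velocity g s))).
Proof.
move=> [_ [s ps sg]] cphi.
have h j : (j < size s)%N ->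
    continuous_piece (fun s => Re (phi s * velocity g s)) (nth 0 (0 :: s) j) (nth 0 s j) /\
    continuous_piece (fun s => Im (phi s * velocity g s)) (nth 0 (0 :: s) j) (nth 0 s j).
  move=> js; apply: curve_integrand_piece; first exact: sg.
  have [h1 _ h2] := itv_partition_piece ps js.
  by apply: continuous_subspaceW cphi; apply: subset_itv; rewrite bnd_simp.
by split; apply: (piecewise_integrable ps) => j /h[].
Qed.

Lemma eq_curve_integral g f1 f2 :
  (forall s, s \in `[0, 1] -> f1 (g s) = f2 (g s)) ->
  curve_integral g f1 = curve_integral g f2.
Proof.
move=> f12; congr (_ +i* _); apply: eq_Rintegral => s;
  by rewrite inE => /f12 ->.
Qed.

Lemma curve_integralD g f1 f2 : piecewise_smooth g ->
  {within I, continuous (f1 \o g)} -> {within I, continuous (f2 \o g)} ->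
  curve_integral g (fun z => f1 z + f2 z) =
  curve_integral g f1 + curve_integral g f2.
Proof.
move=> sg /(curve_integrable sg)[i1 j1] /(curve_integrable sg)[i2 j2].
rewrite /curve_integral; simpc; congr (_ +i* _).
- rewrite -RintegralD//; apply: eq_Rintegral => s _.
  by rewrite /= mulrDl raddfD.
- rewrite -RintegralD//; apply: eq_Rintegral => s _.
  by rewrite /= mulrDl raddfD.
Qed.

(** A complex factor mixes real and imaginary parts, so each component of the result combines both
    real integrals. *)
Lemma curve_integralZ g c f : piecewise_smooth g ->
  {within I, continuous (f \o g)} ->
  curve_integral g (fun z => c * f z) = c * curve_integral g f.
Proof.
move=> sg /(curve_integrable sg)[i j].
have mI : measurable (I : set (measurableTypeR R)) by exact: measurable_itv.
have iZ (x : R) (h : R -> R) : mu.-integrable I (EFin \o h) ->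
    mu.-integrable I (EFin \o (fun s => x * h s)).
  move=> hi; have := integrableZl mI x hi.
  by apply: eq_integrable => // s _; rewrite /= EFinM.
rewrite /curve_integral; case: c => x y; simpc; congr (_ +i* _).
- rewrite -!RintegralZl//.
  rewrite -(RintegralB mI (iZ x _ i) (iZ y _ j)).
  by apply: eq_Rintegral => s _; rewrite -mulrA ReM.
- rewrite -!RintegralZl//.
  rewrite -(RintegralD mI (iZ x _ j) (iZ y _ i)).
  by apply: eq_Rintegral => s _; rewrite -mulrA ImM.
Qed.

Lemma within_continuousM phi1 phi2 : {within I, continuous phi1} ->
  {within I, continuous phi2} -> {within I, continuous (fun s => phi1 s * phi2 s)}.
Proof.
move=> /subspace_continuousP h1 /subspace_continuousP h2.
by apply/subspace_continuousP => s sI; exact: (cvgM (h1 s sI) (h2 s sI)).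
Qed.

Lemma within_continuous_cst c : {within I, continuous (fun=> c : C R)}.
Proof. by apply/subspace_continuousP => s sI; exact: cvg_cst. Qed.

Lemma within_continuousV phi : {within I, continuous phi} ->
  (forall s, I s -> phi s != 0) -> {within I, continuous (fun s => (phi s)^-1)}.
Proof.
move=> /subspace_continuousP h n0.
by apply/subspace_continuousP => s sI; exact: (cvgV (n0 s sI) (h s sI)).
Qed.

Lemma within_continuous_sum {T : Type} (r : seq T) (phi : T -> R -> C R) :
  (forall i, {within I, continuous (phi i)}) ->
  {within I, continuous (fun s => \sum_(i <- r) phi i s)}.
Proof.
move=> cphi; elim: r => [|i r IH].
  have -> : (fun s => \sum_(i <- [::]) phi i s) = (fun=> 0).
    by apply/funext => s; rewrite big_nil.
  exact: (@within_continuous_cst 0).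
have -> : (fun s => \sum_(j <- i :: r) phi j s) =
    (fun s => phi i s + \sum_(j <- r) phi j s).
  by apply/funext => s; rewrite big_cons.
exact (@within_continuousD R (C R) (C R) I _ _ (cphi i) IH).
Qed.

Lemma curve_integral_sum {T : Type} (r : seq T) g (a : T -> C R) (f : T -> C R -> C R) :
  piecewise_smooth g -> (forall i, {within I, continuous (f i \o g)}) ->
  curve_integral g (fun z => \sum_(i <- r) a i * f i z) =
  \sum_(i <- r) a i * curve_integral g (f i).
Proof.
move=> sg cf.
have caf i : {within I, continuous (fun s => a i * f i (g s))}.
  exact (@within_continuousM _ _ (@within_continuous_cst (a i)) (cf i)).
elim: r => [|i r IH].
  rewrite big_nil; transitivity (curve_integral g (fun z => 0 * (fun=> 0) z)).
    by apply: eq_curve_integral => s _; rewrite big_nil mul0r.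
  by rewrite (curve_integralZ _ sg (@within_continuous_cst 0)) mul0r.
rewrite big_cons -IH -(curve_integralZ _ sg (cf i)).
rewrite -(curve_integralD sg (caf i) (within_continuous_sum (r := r) caf)).
by apply: eq_curve_integral => s _; rewrite big_cons.
Qed.

Lemma within_continuous_inv_sub g c : {within I, continuous g} ->
  (forall r, I r -> g r != c) ->
  {within I, continuous (fun r => (g r - c)^-1)}.
Proof.
move=> cg gc; apply: within_continuousV.
  exact (@within_continuousD R (C R) (C R) I g (fun=> - c) cg (@within_continuous_cst (- c))).
by move=> r rI; rewrite subr_eq0; exact: gc.
Qed.

(** The components of [phi] are the log-modulus and a continuous argument of [g - c]. On each smooth
    piece phi' = g' / (g - c), and the piecewise fundamental theorem applies to both components. *)
Lemma curve_integral_log g phi c : piecewise_smooth g ->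
  {within I, continuous phi} ->
  (forall s, s \in `[0, 1] -> cexp (phi s) = g s - c) ->
  curve_integral g (fun z => (z - c)^-1) = phi 1 - phi 0.
Proof.
move=> sg cphi ephi; have [_ [s ps ss]] := sg.
pose X r := Re (g r) - Re c; pose Y r := Im (g r) - Im c.
have gE r : g r - c = X r +i* Y r.
  by rewrite /X /Y; case: (g r) (c) => [? ?] [? ?].
have XE r : r \in `[0, 1] -> X r = expR (Re (phi r)) * cos (Im (phi r)).
  by move=> /ephi; rewrite gE /cexp; simpc => -[-> _].
have YE r : r \in `[0, 1] -> Y r = expR (Re (phi r)) * sin (Im (phi r)).
  by move=> /ephi; rewrite gE /cexp; simpc => -[_ ->].
(* The curve avoids [c] because [g r - c] is an exponential. *)
have cV : {within I, continuous (fun r => (g r - c)^-1)}.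
  apply: within_continuous_inv_sub (proj1 sg) _ => r rI.
  by rewrite -subr_eq0 -ephi ?cexp_neq0.
have cphi' : {in `]0, 1[, continuous phi}.
  by move/(continuous_within_itvP _ (@ltr01 R)) : cphi => [].
have pieces j : (j < size s)%N -> [/\
    {in `](nth 0 (0 :: s) j), (nth 0 s j)[, forall u, u \in `]0, 1[},
    continuous_piece (fun r => Re ((g r - c)^-1 * velocity g r)) (nth 0 (0 :: s) j) (nth 0 s j) &
    continuous_piece (fun r => Im ((g r - c)^-1 * velocity g r)) (nth 0 (0 :: s) j) (nth 0 s j)].
  move=> js; have [h1 _ h2] := itv_partition_piece ps js.
  have cV' : {within `[(nth 0 (0 :: s) j), (nth 0 s j)], continuous (fun r => (g r - c)^-1)}.
    by apply: continuous_subspaceW cV; apply: subset_itv; rewrite bnd_simp.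
  have [p1 p2] := curve_integrand_piece (ss j js) cV'.
  by split => // u; apply: subset_itv; rewrite bnd_simp.
have dphi j : (j < size s)%N -> forall u, u \in `](nth 0 (0 :: s) j), (nth 0 s j)[ ->
    is_derive u 1 (fun r => Re (phi r)) (Re ((g u - c)^-1 * velocity g u)) /\
    is_derive u 1 (fun r => Im (phi r)) (Im ((g u - c)^-1 * velocity g u)).
  move=> js u uj; have [/(_ _ uj) u01 _ _] := pieces j js.
  have [v [_ _ /(_ u uj)[dX dY]]] := smooth_on_velocity (ss j js).
  have dX' : is_derive u 1 X (Re (velocity g u)).
    by apply: trigger_derive (is_deriveB dX (is_derive_cst (Re c) u 1)) _; rewrite subr0.
  have dY' : is_derive u 1 Y (Im (velocity g u)).
    by apply: trigger_derive (is_deriveB dY (is_derive_cst (Im c) u 1)) _; rewrite subr0.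
  have n01 : \forall r \near u, r \in `[0, 1].
    have := near_in_itvoo u01; apply: (filterS (F := nbhs u)) => r.
    exact: subset_itv_oo_cc.
  have nX : \forall r \near u, X r = expR (Re (phi r)) * cos (Im (phi r)).
    by apply: (filterS (F := nbhs u)) n01 => r /XE.
  have nY : \forall r \near u, Y r = expR (Re (phi r)) * sin (Im (phi r)).
    by apply: (filterS (F := nbhs u)) n01 => r /YE.
  have dR : is_derive u 1 (fun r => Re (phi r))
      ((X u * Re (velocity g u) + Y u * Im (velocity g u)) / (X u ^+ 2 + Y u ^+ 2)).
    apply: is_derive_log_modulus; rewrite ?uj//.
    apply: (filterS (F := nbhs u)) n01 => r r01.
    by rewrite XE// YE// !exprMn -mulrDr cos2Dsin2 mulr1.
  have cI : Im (phi r) @[r --> u] --> Im (phi u).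
    exact: (Im_cvg (F := nbhs u) (cphi' u u01)).
  have dI := is_derive_argument nX nY cI dR dX' dY'.
  split.
    (* The complex inverse unfolds to the conjugate over the squared modulus, which matches the real
       formula. *)
    apply: trigger_derive dR _; rewrite gE; case: (velocity g u) => p q /=.
    by ring.
  apply: trigger_derive dI _; rewrite gE; case: (velocity g u) => p q /=.
  by ring.
have -> : curve_integral g (fun z => (z - c)^-1) =
    (Re (phi 1) - Re (phi 0)) +i* (Im (phi 1) - Im (phi 0)).
  congr (_ +i* _).
  - apply: (@piecewise_FTC _ _ (fun r => Re (phi r)) _ _ _ ps).
    + by move=> j /pieces[].
    + apply/subspace_continuousP => r rI.
      by move/subspace_continuousP : cphi => /(_ r rI)/Re_cvg.
    + by move=> j js u uj; have [] := dphi j js u uj.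
  - apply: (@piecewise_FTC _ _ (fun r => Im (phi r)) _ _ _ ps).
    + by move=> j /pieces[].
    + apply/subspace_continuousP => r rI.
      by move/subspace_continuousP : cphi => /(_ r rI)/Im_cvg.
    + by move=> j js u uj; have [] := dphi j js u uj.
by case: (phi 1) (phi 0) => [? ?] [? ?]; simpc.
Qed.
End CurveIntegral.

(** * Rational functions *)

Section PartialFractions.
Context {K : fieldType}.
Implicit Types F D : {poly K}.

(** Lagrange interpolation at the [n] distinct roots of [F], after a multiple of [F] is subtracted
    from [D] to bring its degree below [n]; that multiple becomes the constant term. *)
Lemma partial_fraction F D n (c : 'I_n -> K) z :
  injective c -> size F = n.+1 -> (size D <= n.+1)%N ->
  (forall i, root F (c i)) -> ~~ root F z ->
  D.[z] / F.[z] =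
    D`_n / lead_coef F + \sum_(i < n) D.[c i] / F^`().[c i] * (z - c i)^-1.
Proof.
move=> ic sF sD rF; rewrite rootE => Fz0.
have F0 : F != 0 by rewrite -size_poly_gt0 sF.
set l := lead_coef F; have l0 : l != 0 by rewrite lead_coef_eq0.
(* [Q i] is [F] without its factor at [c i] and without its leading coefficient, so F'(c_i) = l
   Q_i(c_i). *)
pose Q i := \prod_(j < n | j != i) ('X - (c j)%:P).
have FP : F = l *: \prod_(x <- [seq c i | i <- enum 'I_n]) ('X - x%:P).
  apply: all_roots_prod_XsubC.
  - by rewrite size_map sF size_enum_ord.
  - by apply/allP => x /mapP[j _ ->].
  - by rewrite uniq_rootsE map_inj_uniq // enum_uniq.
have FQ i : F = l *: (('X - (c i)%:P) * Q i).
  by rewrite {1}FP big_map big_enum (bigD1 i).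
have Qr i j : j != i -> (Q i).[c j] = 0.
  by move=> ji; rewrite /Q horner_prod (bigD1 j)//= !hornerE subrr mul0r.
have Qn0 i : (Q i).[c i] != 0.
  rewrite /Q horner_prod prodf_seq_neq0; apply/allP => j _; apply/implyP => ji.
  by rewrite !hornerE subr_eq0 (inj_eq ic) eq_sym.
have dF i : F^`().[c i] = l * (Q i).[c i].
  by rewrite (FQ i) derivZ derivM derivXsubC !hornerE subrr mul0r addr0.
have sQ i : size (Q i) = n.
  have Q0 : Q i != 0 by apply: contraNneq (Qn0 i) => ->; rewrite horner0.
  apply/eqP; rewrite -eqSS -sF {1}(FQ i) size_scale// mulrC.
  by rewrite size_Mmonic ?monicXsubC// size_XsubC addn2.
(* The interpolation error has [n] distinct roots and degree below [n], hence vanishes. *)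
pose P := D - (D`_n / l) *: F - \sum_(i < n) (D.[c i] / (Q i).[c i]) *: Q i.
have P0 : P = 0.
  apply/eqP/negPn/negP => P0.
  have := max_poly_roots (rs := map c (enum 'I_n)) P0.
  rewrite map_inj_uniq ?enum_uniq// size_map size_enum_ord.
  have -> : all (root P) [seq c i | i <- enum 'I_n].
    apply/allP => x /mapP[j _ ->]; rewrite rootE /P !hornerE horner_sum.
    rewrite (bigD1 j)//= big1 => [|i ij]; last first.
      by rewrite eq_sym in ij; rewrite hornerZ (Qr _ _ ij) mulr0.
    by rewrite hornerZ (rootP (rF j)) mulr0 subr0 addr0 divfK// subrr.
  move=> /(_ isT isT); apply/negP; rewrite -leqNgt.
  apply/leq_sizeP => j nj; rewrite /P !coefB coef_sum big1 => [|i _]; last first.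
    by rewrite coefZ nth_default ?mulr0// sQ.
  (* In degree [n] the multiple of [F] was chosen to cancel [D]; beyond it both have zero
     coefficients. *)
  rewrite subr0 coefZ; move: nj; rewrite leq_eqVlt => /predU1P[<-|nj].
    by rewrite /l lead_coefE sF /= divfK ?subrr// -[n]/(n.+1.-1) -sF -lead_coefE.
  have -> : D`_j = 0 by rewrite nth_default ?(leq_trans sD).
  have -> : F`_j = 0 by rewrite nth_default ?sF.
  by rewrite mulr0 subrr.
have zc i : z - c i != 0.
  by apply: contraNN Fz0; rewrite subr_eq0 => /eqP ->; exact: rF.
have : P.[z] = 0 by rewrite P0 horner0.
rewrite /P !hornerE horner_sum => /eqP; rewrite subr_eq0 subr_eq addrC => /eqP ->.
rewrite mulrDl mulfK//; congr (_ + _); rewrite mulr_suml; apply: eq_bigr => i _.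
rewrite dF hornerZ [X in _ / X](_ : _ = l * ((z - c i) * (Q i).[z])); last first.
  by rewrite {1}(FQ i) !hornerE.
have Qz : (Q i).[z] != 0.
  by apply: contraNneq Fz0 => Qz; rewrite (FQ i) hornerZ hornerM Qz !mulr0.
by field; rewrite l0 Qz Qn0 zc.
Qed.

End PartialFractions.

(** * Limits of polynomials, simple roots and derivatives of quotients *)

Section PolynomialLimits.
Context {K : numFieldType}.
Implicit Types (p N D : {poly K}) (a c t : K).

Lemma cvg_horner {T : Type} {F : set_system T} {FF : Filter F} (f : T -> K) p a :
  f @ F --> a -> p.[f x] @[x --> F] --> p.[a].
Proof.
move=> fa; elim/poly_ind: p => [|p b IH].
  by under eq_fun do rewrite horner0; rewrite horner0; exact: cvg_cst.
rewrite hornerMXaddC; under eq_fun do rewrite hornerMXaddC.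
by apply: cvgD; [exact: cvgM|exact: cvg_cst].
Qed.

Lemma cvg_ratio {T : Type} {F : set_system T} {FF : Filter F} N D (f : T -> K) a :
  f @ F --> a -> D.[a] != 0 -> N.[f x] / D.[f x] @[x --> F] --> N.[a] / D.[a].
Proof.
by move=> fa Da; apply: cvgM; [|apply: cvgV => //]; exact: cvg_horner.
Qed.

(** The quotient (p(x) - p(y)) / (x - y), built by the Horner recursion so that it stays meaningful
    and continuous on the diagonal, where it equals p'. *)
Lemma divided_difference p : exists d : K -> K -> K,
  (forall x y, p.[x] - p.[y] = (x - y) * d x y) /\
  forall (T : Type) (F : set_system T) (x y : T -> K) c, Filter F ->
    x @ F --> c -> y @ F --> c -> d (x u) (y u) @[u --> F] --> p^`().[c].
Proof.
elim/poly_ind: p => [|p b [d [dE dc]]].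
  exists (fun _ _ => 0); split=> [x y|T F x y c FF _ _].
    by rewrite !horner0 subrr mulr0.
  by rewrite deriv0 horner0; exact: cvg_cst.
exists (fun x y => d x y * x + p.[y]); split=> [x y|T F x y c FF xc yc].
  have e : p.[x] = (x - y) * d x y + p.[y] by rewrite -dE subrK.
  by rewrite !hornerMXaddC e; ring.
rewrite derivMXaddC hornerD hornerMX addrC.
by apply: cvgD; [apply: cvgM => //; exact: dc|exact: cvg_horner].
Qed.

(* If x u and y u were different, the divided difference of [N - u *: D]
   between them would vanish, whereas it tends to [(N - t *: D)^`().[c]]. *)
Lemma simple_root_unique N D c t (x y : K -> K) :
  (N - t *: D)^`().[c] != 0 -> x u @[u --> t] --> c -> y u @[u --> t] --> c ->
  (\forall u \near t, N.[x u] = u * D.[x u]) ->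
  (\forall u \near t, N.[y u] = u * D.[y u]) ->
  \forall u \near t, x u = y u.
Proof.
move=> dF xc yc xE yE.
have [dN [dNE dNc]] := divided_difference N.
have [dD [dDE dDc]] := divided_difference D.
have lim : dN (x u) (y u) - u * dD (x u) (y u) @[u --> t] -->
    N^`().[c] - t * D^`().[c].
  apply: (cvgB (F := nbhs t)); first exact: dNc.
  by apply: (cvgM (F := nbhs t)); [exact: cvg_id|exact: dDc].
have dF' : N^`().[c] - t * D^`().[c] != 0.
  by move: dF; rewrite derivB derivZ hornerD hornerN hornerZ.
have n0 : \forall u \near t, dN (x u) (y u) - u * dD (x u) (y u) != 0.
  exact: (cvgr_neq0 _ lim dF').
apply: (filterS3 (F := nbhs t)) xE yE n0 => u xu yu; apply: contraNeq => xy.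
have xy0 : x u - y u != 0 by rewrite subr_eq0.
rewrite -(inj_eq (mulfI xy0)) mulr0 mulrBr mulrCA -dNE -dDE xu yu; apply/eqP.
by ring.
Qed.

(** With [s] the value at [c], N/D - s is the quotient of [G = N - s *: D] by [D], and [G] vanishes
    at [c]. This ties P' to the derivative of the fibre polynomial. *)
Lemma derive1_ratio N D c : D.[c] != 0 ->
  derive1 (fun z => N.[z] / D.[z]) c =
  (N - (N.[c] / D.[c]) *: D)^`().[c] / D.[c].
Proof.
move=> Dc; set s := N.[c] / D.[c]; set G := N - s *: D.
have Gc : G.[c] = 0 by rewrite /G !hornerE /s divfK// subrr.
have [d [dE dc]] := divided_difference G.
apply: cvg_lim; first exact: norm_hausdorff.
have hc : h + c @[h --> 0^'] --> c.
  rewrite -[X in _ --> X]add0r; apply: cvgD; last exact: cvg_cst.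
  exact: nbhs_dnbhs.
have lim : d (h + c) c / D.[h + c] @[h --> 0^'] --> G^`().[c] / D.[c].
  apply: cvgM; first by apply: dc => //; exact: cvg_cst.
  by apply: cvgV => //; exact: cvg_horner.
apply: cvg_trans lim; apply: near_eq_cvg.
have Dn : \forall h \near 0^', D.[h + c] != 0.
  by apply: (cvgr_neq0 _ (cvg_horner hc) Dc).
near=> h.
have h0 : h != 0 by near: h; exact: nbhs_dnbhs_neq.
have Dh : D.[h + c] != 0 by near: h.
have -> : N.[h + c] / D.[h + c] - s = (G.[h + c] - G.[c]) / D.[h + c].
  by rewrite Gc subr0 /G !hornerE mulrBl mulfK.
rewrite dE addrK /GRing.scale /=.
by rewrite mulrA mulrA mulVf// mul1r.
Unshelve. all: by end_near. Qed.
End PolynomialLimits.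

(** * Fibres and local degrees of rational maps *)

Section RationalMaps.
Context {R : realType}.
Implicit Types (P : {fraction {poly C R}}) (s t c z : C R).

Lemma ratden_neq0 P : ratden P != 0.
Proof.
rewrite /ratden; have := denom_ratioP (repr P); case: (frac _) => a b /= b0.
by apply: contraNneq b0 => e; rewrite -(divpK (dvdp_gcdr a b)) e mul0r.
Qed.

Lemma coprimep_ratnum_ratden P : coprimep (ratnum P) (ratden P).
Proof.
rewrite /ratnum /ratden; have := denom_ratioP (repr P).
by case: (frac _) => a b /= b0; rewrite coprimep_div_gcd// b0 orbT.
Qed.

Lemma size_ratnum P : (size (ratnum P) <= (ratdeg P).+1)%N.
Proof.
by rewrite /ratdeg prednK ?leq_maxl// leq_max !size_poly_gt0 ratden_neq0 orbT.
Qed.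

Lemma size_ratden P : (size (ratden P) <= (ratdeg P).+1)%N.
Proof.
by rewrite /ratdeg prednK ?leq_maxr// leq_max !size_poly_gt0 ratden_neq0 orbT.
Qed.

(** One equation in the top degree covers both cases for the value at infinity: if that value is
    infinite, the coefficient of the denominator is 0 and that of the numerator is not. *)
Lemma ratmap_infty_coef P s :
  (ratmap P None == Some s) = ((ratnum P)`_(ratdeg P) == s * (ratden P)`_(ratdeg P)).
Proof.
rewrite /=; have D0 : (0 < size (ratden P))%N by rewrite size_poly_gt0 ratden_neq0.
case: ltnP => ND; rewrite /ratdeg.
  rewrite (maxn_idPl (ltnW ND)) -lead_coefE [(ratden P)`__]nth_default; last first.
    by rewrite -ltnS (ltn_predK ND).
  rewrite mulr0 lead_coef_eq0; apply/esym/negbTE.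
  by rewrite -size_poly_gt0 (leq_ltn_trans _ ND).
rewrite (maxn_idPr ND) -[in RHS]lead_coefE -[LHS]/(_ / _ == s).
have l0 : lead_coef (ratden P) != 0 by rewrite lead_coef_eq0 ratden_neq0.
by apply/eqP/eqP => [<-|->]; rewrite ?divfK ?mulfK.
Qed.

(** The top coefficient vanishes only for [s] equal to the value at infinity, so otherwise no point
    of the fibre escapes to infinity. *)
Lemma size_fibre_poly P s : ratmap P None != Some s ->
  size (fibre_poly P (Some s)) = (ratdeg P).+1.
Proof.
rewrite ratmap_infty_coef -subr_eq0 => h; apply/eqP; rewrite eqn_leq; apply/andP; split.
  apply: leq_trans (size_polyD _ _) _; rewrite geq_max size_ratnum size_polyN.
  exact: leq_trans (size_scale_leq _ _) (size_ratden _).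
rewrite ltnNge; apply: contra h => h.
by rewrite -coefZ -coefB; apply/eqP; exact: nth_default.
Qed.

(** Identifies the constant term of the partial fraction expansion; it is 0 when P(infinity) is
    infinite, the denominator then having smaller degree. *)
Lemma lead_coef_fibre_poly P s : ratmap P None != Some s ->
  (ratden P)`_(ratdeg P) / lead_coef (fibre_poly P (Some s)) = inv_at_infty P s.
Proof.
move=> h; rewrite lead_coefE size_fibre_poly//= coefB coefZ /inv_at_infty.
have D0 : (0 < size (ratden P))%N by rewrite size_poly_gt0 ratden_neq0.
move: h; rewrite /=; case: ltnP => ND; rewrite /ratdeg.
  rewrite (maxn_idPl (ltnW ND)) [(ratden P)`__]nth_default ?mul0r//.
  by rewrite -ltnS (ltn_predK ND).
rewrite (maxn_idPr ND) -[(ratden P)`__]lead_coefE => h.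
have l0 : lead_coef (ratden P) != 0 by rewrite lead_coef_eq0 ratden_neq0.
set x := (ratnum P)`__; set l := lead_coef _ in l0 *.
have -> : x - s * l = (x / l - s) * l by rewrite mulrBl divfK.
by rewrite invfM mulrCA divff ?mulr1.
Qed.

(** If the numerator were [s] times the denominator, coprimality would make both constant. *)
Lemma fibre_poly_neq0 P s : (0 < ratdeg P)%N -> fibre_poly P (Some s) != 0.
Proof.
move=> n0; apply/negP; rewrite subr_eq0 => /eqP e.
have sD : size (ratden P) = 1%N.
  apply/eqP; rewrite -coprimepp; have := coprimep_ratnum_ratden P; rewrite e.
  have [->|s0] := eqVneq s 0; last by rewrite coprimepZl.
  by rewrite scale0r coprime0p -size_poly_eq1 coprimepp.
move: n0; rewrite /ratdeg e sD.
have := size_scale_leq s (ratden P); rewrite sD => /maxn_idPr ->.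
by [].
Qed.

Lemma ratmap_finite P z s : ratmap P (Some z) = Some s ->
  [/\ (ratden P).[z] != 0, root (fibre_poly P (Some s)) z &
      (ratnum P).[z] = s * (ratden P).[z]].
Proof.
rewrite /= /ratpole rootE; case: eqVneq => //= D0 [<-].
by split => //; rewrite ?rootE ?hornerE /rateval divfK// subrr.
Qed.

(** A common root [z] of the fibre polynomial and its derivative would be at least double. *)
Lemma multiplicity_finite P z s : (0 < ratdeg P)%N ->
  ratmap P (Some z) = Some s -> (multiplicity P (Some z) <= 1)%N ->
  (fibre_poly P (Some s))^`().[z] != 0.
Proof.
move=> n0 Pz; rewrite /multiplicity Pz.
have [_ /factor_theorem[Q FQ] _] := ratmap_finite Pz.
have F0 := fibre_poly_neq0 s n0.
rewrite mup_leq// FQ; apply: contraNneq.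
rewrite derivM derivXsubC !hornerE subrr mulr0 add0r.
by move/eqP/factor_theorem => [Q' ->]; rewrite -mulrA -expr2 dvdp_mulIr.
Qed.

(** The top coefficient vanishes here, and local degree at most 1 means that only one degree is
    lost, so the next coefficient is the leading one. It is the derivative at 0 of the fibre
    equation in the chart 1/z. *)
Lemma multiplicity_infty P s : (0 < ratdeg P)%N ->
  ratmap P None = Some s -> (multiplicity P None <= 1)%N ->
  (fibre_poly P (Some s))`_(ratdeg P).-1 != 0.
Proof.
move=> n0 Pz; rewrite /multiplicity Pz.
have F0 := fibre_poly_neq0 s n0; set F := fibre_poly _ _ in F0 *.
have Fn : F`_(ratdeg P) = 0.
  apply/eqP; rewrite coefB coefZ subr_eq0 -ratmap_infty_coef.
  exact/eqP.
have sF : (size F <= ratdeg P)%N.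
  have : (size F <= (ratdeg P).+1)%N.
    apply: leq_trans (size_polyD _ _) _; rewrite geq_max size_ratnum size_polyN.
    exact: leq_trans (size_scale_leq _ _) (size_ratden _).
  rewrite leq_eqVlt => /predU1P[e|//].
  by move: F0; rewrite -lead_coef_eq0 lead_coefE e /= Fn eqxx.
have s0 : (0 < size F)%N by rewrite size_poly_gt0.
move=> m1; have -> : ((ratdeg P).-1 = (size F).-1)%N by lia.
by rewrite -lead_coefE lead_coef_eq0.
Qed.

End RationalMaps.

(** * Branches of the inverse of a rational function *)

Section ReversedPolynomial.
Context {K : fieldType}.
Implicit Types p : {poly K}.

(* The numerator, in the chart w = 1/z, of a polynomial of degree at most n. *)
Definition revpoly n p : {poly K} := \poly_(i < n.+1) p`_(n - i).

Lemma horner_revpoly n p w : (size p <= n.+1)%N -> w != 0 ->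
  (revpoly n p).[w] = w ^+ n * p.[w^-1].
Proof.
move=> sp w0; rewrite horner_poly (horner_coef_wide _ sp) mulr_sumr.
rewrite (reindex_inj rev_ord_inj) /=; apply: eq_bigr => i _.
have ni : (i <= n)%N by rewrite -ltnS.
rewrite subSS (subKn ni) exprVn mulrCA; congr (_ * _).
have -> : w ^+ n = w ^+ (n - i) * w ^+ i by rewrite -exprD subnK.
by rewrite mulfK// expf_neq0.
Qed.

Lemma coef_revpoly n p i : (i <= n)%N -> (revpoly n p)`_i = p`_(n - i).
Proof. by move=> ni; rewrite coef_poly ltnS ni. Qed.

End ReversedPolynomial.

Lemma near_neq {K : numFieldType} {T : Type} {F : set_system T} {FF : Filter F}
    (f g : T -> K) (c d : K) : f @ F --> c -> g @ F --> d -> c != d ->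
  \forall x \near F, f x != g x.
Proof.
move=> fc gd cd; have cd0 : c - d != 0 by rewrite subr_eq0.
have : \forall x \near F, f x - g x != 0 by exact: (cvgr_neq0 _ (cvgB fc gd) cd0).
by apply: filterS => x; rewrite subr_eq0.
Qed.

(** Separates a branch tending to infinity, read as [f] in the chart 1/z, from a branch [g] with a
    finite limit: where they agree, the product is 1. *)
Lemma near_mul_neq1 {K : numFieldType} {T : Type} {F : set_system T} {FF : Filter F}
    (f g : T -> K) (c : K) : f @ F --> (0 : K) -> g @ F --> c ->
  \forall x \near F, f x * g x != 1.
Proof.
move=> f0 gc; have c1 : 0 * c != 1 by rewrite mul0r eq_sym oner_eq0.
exact: (near_neq (cvgM f0 gc) (cvg_cst (1 : K)) c1).
Qed.

Section InverseBranches.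
Context {R : realType}.
Implicit Types (P : {fraction {poly C R}}) (s t c z : C R) (x : CP1 R).
Implicit Types b : C R -> CP1 R.

(* The point 0 is excluded because the junk value of finpart makes the chart 1/z
   take the value 0 there, as it does at infinity. *)
Lemma CP1_inv_finpart_inj x1 x2 : x1 <> Some 0 -> x2 <> Some 0 ->
  finpart (CP1_inv x1) = finpart (CP1_inv x2) -> x1 = x2.
Proof.
case: x1 x2 => [z1|] [z2|] //=.
- have [->//|z10] := eqVneq z1 0; have [->//|z20] := eqVneq z2 0.
  by move=> _ _ /= /invr_inj ->.
- by have [->//|z10] := eqVneq z1 0; move=> _ _ /= /eqP; rewrite invr_eq0 (negbTE z10).
- have [->//|z20] := eqVneq z2 0; move=> _ _ /= /esym/eqP.
  by rewrite invr_eq0 (negbTE z20).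
Qed.

(** The fibre equation multiplied by w^n, with w = 1/z; at infinity it compares the coefficients in
    degree [ratdeg P]. *)
Lemma ratmap_chart_infty P x s : ratmap P x = Some s -> x <> Some 0 ->
  (revpoly (ratdeg P) (ratnum P)).[finpart (CP1_inv x)] =
  s * (revpoly (ratdeg P) (ratden P)).[finpart (CP1_inv x)].
Proof.
case: x => [z|] Pz z0.
  have zn0 : z != 0 by apply: contra_notN z0 => /eqP ->.
  rewrite /= (negbTE zn0) /= !horner_revpoly ?invr_eq0 ?size_ratnum ?size_ratden//.
  by have [_ _ ] := ratmap_finite Pz; rewrite invrK => ->; rewrite mulrCA.
rewrite /= !horner_coef0 !coef_revpoly// subn0.
by apply/eqP; rewrite -ratmap_infty_coef Pz.
Qed.

Lemma branch_near_finite b t c : {for t, continuous b} -> b t = Some c ->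
  (\forall s \near t, b s = Some (finpart (b s))) /\
  (finpart (b s) @[s --> t] --> c).
Proof.
move=> cb bt.
have key (A : set (C R)) : nbhs c A -> \forall s \near t, exists2 z, A z & Some z = b s.
  move=> cA.
  have /cb : nbhs (b t) ((Some : C R -> CP1 R) @` A).
    by rewrite bt; exact: one_point_compactification_some_nbhs.
  by [].
split.
  have cT : nbhs c setT by exact: filterT.
  by have h := key _ cT; apply: (filterS (F := nbhs t) _ h) => s [z _ <-].
move=> A cA; suff : \forall s \near t, A (finpart (b s)) by [].
by have := key A cA; apply: (filterS (F := nbhs t)) => s [z Az <-].
Qed.

Lemma branch_near_infty b t : CP1_analytic_at b t -> b t = None ->
  (\forall s \near t, b s <> Some 0) /\
  (finpart (CP1_inv (b s)) @[s --> t] --> (0 : C R)).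
Proof.
move=> [cb ab] bt; split; last first.
  rewrite bt in ab; have := analytic_at_continuous ab.
  by rewrite /= bt.
(* The complement of the compact set {0} is a neighbourhood of infinity. *)
have : nbhs (b t) [set x | x <> Some (0 : C R)].
  rewrite bt; exists [set 0].
    split; first exact: compact_set1.
    apply: accessible_closed_set1; apply: hausdorff_accessible.
    exact: norm_hausdorff.
  by move=> x [[z z0 <-] [ez]|-> //]; apply: z0.
by move=> /cb.
Qed.

(** The common value is a simple root of the fibre equation, in the chart z or 1/z according to
    whether it is finite, and [simple_root_unique] applies. *)
Lemma branches_agree P b1 b2 t : (0 < ratdeg P)%N ->
  CP1_analytic_at b1 t -> CP1_analytic_at b2 t ->
  (\forall s \near t, ratmap P (b1 s) = Some s) ->
  (\forall s \near t, ratmap P (b2 s) = Some s) ->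
  (multiplicity P (b1 t) <= 1)%N -> b1 t = b2 t ->
  \forall s \near t, b1 s = b2 s.
Proof.
move=> n0 a1 a2 P1 P2 m1 b12.
have Pt := nbhs_singleton P1.
have [[c b1t]|b1t] : (exists c, b1 t = Some c) \/ b1 t = None.
  by case: (b1 t) => [c|]; [left; exists c|right].
- have b2t : b2 t = Some c by rewrite -b12.
  have [s1 c1] := branch_near_finite (proj1 a1) b1t.
  have [s2 c2] := branch_near_finite (proj1 a2) b2t.
  rewrite b1t in Pt m1; have dF := multiplicity_finite n0 Pt m1.
  have h (b : C R -> CP1 R) : (\forall s \near t, ratmap P (b s) = Some s) ->
      (\forall s \near t, b s = Some (finpart (b s))) ->
      \forall s \near t, (ratnum P).[finpart (b s)] = s * (ratden P).[finpart (b s)].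
    apply: (filterS2 (F := nbhs t)) => s Ps bs; rewrite bs in Ps.
    by have [] := ratmap_finite Ps.
  have := @simple_root_unique (C R) _ _ _ _ _ _ dF c1 c2 (h _ P1 s1) (h _ P2 s2).
  by apply: (filterS3 (F := nbhs t)) s1 s2 => s e1 e2 e3; rewrite e1 e2 e3.
- have b2t : b2 t = None by rewrite -b12.
  have [s1 c1] := branch_near_infty a1 b1t.
  have [s2 c2] := branch_near_infty a2 b2t.
  rewrite b1t in Pt m1; have cF := multiplicity_infty n0 Pt m1.
  have h (b : C R -> CP1 R) : (\forall s \near t, ratmap P (b s) = Some s) ->
      (\forall s \near t, b s <> Some 0) ->
      \forall s \near t, (revpoly (ratdeg P) (ratnum P)).[finpart (CP1_inv (b s))] =
        s * (revpoly (ratdeg P) (ratden P)).[finpart (CP1_inv (b s))].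
    by apply: (filterS2 (F := nbhs t)) => s; exact: ratmap_chart_infty.
  (* The derivative at 0 of the reversed polynomial is its coefficient of index 1, which is the
     original one in degree [(ratdeg P).-1]. *)
  have dF : (revpoly (ratdeg P) (ratnum P) - t *: revpoly (ratdeg P) (ratden P))^`().[0] != 0.
    rewrite horner_coef0 coef_deriv coefB coefZ !coef_revpoly// mulr1n subn1.
    by move: cF; rewrite coefB coefZ.
  have := @simple_root_unique (C R) _ _ _ _ _ _ dF c1 c2 (h _ P1 s1) (h _ P2 s2).
  apply: (filterS3 (F := nbhs t)) s1 s2 => s s1 s2.
  exact: CP1_inv_finpart_inj.
Qed.

Lemma branches_disagree b1 b2 t : CP1_analytic_at b1 t -> CP1_analytic_at b2 t ->
  b1 t <> b2 t -> \forall s \near t, b1 s <> b2 s.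
Proof.
have mixed b b' : CP1_analytic_at b t -> CP1_analytic_at b' t ->
    forall c, b t = None -> b' t = Some c -> \forall s \near t, b s <> b' s.
  move=> a a' c bt bt'.
  have [s1 c1] := branch_near_infty a bt.
  have [s2 c2] := branch_near_finite (proj1 a') bt'.
  have : \forall s \near t, finpart (CP1_inv (b s)) * finpart (b' s) != 1.
    exact: (near_mul_neq1 c1 c2).
  apply: (filterS3 (F := nbhs t)) s1 s2 => s b0 -> /eqP n1 e; apply: n1.
  move: b0; rewrite e /=; case: eqVneq => [-> //|z0 _] /=.
  by rewrite mulVf.
move=> a1 a2; case e1: (b1 t) => [c|]; case e2: (b2 t) => [d|] // b12.
- have [s1 c1] := branch_near_finite (proj1 a1) e1.
  have [s2 c2] := branch_near_finite (proj1 a2) e2.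
  have cd : c != d by apply: contra_notN b12 => /eqP ->.
  have h : \forall s \near t, finpart (b1 s) != finpart (b2 s).
    exact: (near_neq c1 c2 cd).
  by apply: (filterS (F := nbhs t) _ h) => s; apply: contraNnot => ->.
- have h := mixed _ _ a2 a1 _ e2 e1.
  by apply: (filterS (F := nbhs t) _ h) => s n e; exact: n.
- exact: mixed e1 e2.
Qed.

Lemma inverse_branches_distinct P n U (B : 'I_n -> C R -> CP1 R) :
  ratdeg P = n -> open U -> connected U -> (Some @` U) `&` branch_points P = set0 ->
  inverse_branches P U B -> forall s, U s -> injective (B ^~ s).
Proof.
move=> Pn oU cU U0 [aB PB dB] s Us i j /= Bs; apply/eqP/negPn/negP => ij.
have [t Ut Bt] := dB _ _ ij; apply: Bt; move: t Ut.
apply: (connected_locally_constant cU); first by exists s.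
- move=> t Ut Bt.
  have nU := open_nbhs_nbhs (conj oU Ut).
  have nP k : \forall s \near t, ratmap P (B k s) = Some s.
    by apply: (filterS (F := nbhs t)) nU => u; exact: PB.
  (* [U] avoids the branch points, so [P] is unramified at the common value of the two branches. *)
  have m1 : (multiplicity P (B i t) <= 1)%N.
    rewrite leqNgt; apply/negP => m1.
    have : ((Some @` U) `&` branch_points P) (Some t).
      by split; [exists t|exists (B i t) => //; exact: PB].
    by rewrite U0.
  (* The degree is positive because the index [i] inhabits ['I_n]. *)
  have n0 : (0 < ratdeg P)%N by rewrite Pn (leq_ltn_trans _ (ltn_ord i)).
  have h := branches_agree n0 (aB i t Ut) (aB j t Ut) (nP i) (nP j) m1 Bt.
  by apply: (filterS (F := nbhs t) _ h).
- move=> t Ut Bt; have h := branches_disagree (aB i t Ut) (aB j t Ut) Bt.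
  by apply: (filterS (F := nbhs t) _ h).
Qed.
End InverseBranches.

Lemma nbhs_distP {K : numFieldType} (z : K) (A : set K) :
  nbhs z A <-> exists2 e : K, 0 < e & forall w, `|z - w| < e -> A w.
Proof.
split => [/nbhs_ballP[e /= e0 eA]|[e e0 eA]].
  by exists e => // w zw; apply: eA; rewrite -ball_normE.
by apply/nbhs_ballP; exists e => //= w; rewrite -ball_normE; exact: eA.
Qed.

(** * Openness of the outer component at finite points *)

Section OuterComponent.
Context {R : realType}.
Notation I := (`[0, 1]%classic : set R).
Implicit Types (P : {fraction {poly C R}}) (g : R -> C R) (s t : C R).

Lemma within_continuous_rateval P g : {within I, continuous g} ->
  (forall r, r \in `[0, 1] -> ~~ ratpole P (g r)) ->
  {within I, continuous (rateval P \o g)}.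
Proof.
move=> /subspace_continuousP cg nP; apply/subspace_continuousP => r rI.
have Dr : (ratden P).[g r] != 0 by exact: nP.
have gr : g u @[u --> within I (nbhs r)] --> g r := cg r rI.
exact: (@cvg_ratio (C R) _ _ _ (ratnum P) (ratden P) g (g r) gr Dr).
Qed.

(** The image of the curve is compact, so a ball about [t] misses it; a segment in this ball joins
    [t] to any of its points without leaving the component. *)
Lemma U_infty_near P g t : {within I, continuous g} ->
  (forall r, r \in `[0, 1] -> ~~ ratpole P (g r)) ->
  U_infty P g (Some t) -> \forall s \near t, U_infty P g (Some s).
Proof.
move=> cg nP [A [AN AP cA] At].
pose K := (rateval P \o g) @` I.
have cK : compact K.
  by apply: continuous_compact; [exact: within_continuous_rateval|exact: segment_compact].
have clK : closed K by apply: compact_closed => //; exact: norm_hausdorff.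
have KP : forall s, ~ K s -> (~` (ratmap P @` (Some @` trace g))) (Some s).
  move=> s nKs [x [z [r rI <-] <-]] Ps; apply: nKs; exists r => //=.
  by move: Ps; rewrite /= (negbTE (nP r rI)) => -[].
have nKt : ~ K t.
  move=> [r rI Kt]; apply: (AP _ At); exists (Some (g r)); first by exists (g r) => //; exists r.
  by rewrite /= (negbTE (nP r rI)) -Kt.
have : nbhs t (~` K) by apply: open_nbhs_nbhs; split => //; exact: closed_openC.
move=> /nbhs_distP[e e0 eK]; apply/nbhs_distP; exists e => // s ts.
pose h (r : R) : C R := t + r%:C * (s - t).
have ch : continuous h.
  move=> r; apply: (cvgD (F := nbhs r)); first exact: cvg_cst.
  apply: (cvgM (F := nbhs r)); last exact: cvg_cst.
  by apply: (complex_cvg (F := nbhs r)); [exact: cvg_id|exact: cvg_cst].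
(* The connected set joining infinity to [t], prolonged by the segment from [t] to [s]. *)
exists (A `|` (fun r => Some (h r) : CP1 R) @` I).
  split.
  - by left.
  - move=> x [/AP//|[r rI <-]]; apply: KP; apply: eK.
    rewrite /h opprD addrA subrr sub0r normrN normrM distrC.
    apply: le_lt_trans ts; rewrite ler_piMl// normc_real lecR.
    by move: rI; rewrite /= in_itv /= => /andP[r0 r1]; rewrite ger0_norm.
  - apply: connectedU => //.
    + exists (Some t); split => //; exists 0; rewrite /= ?in_itv /= ?lexx ?ler01//.
      by rewrite /h mul0r addr0.
    + apply: connected_continuous_connected; first exact: segment_connected.
      apply: continuous_subspaceT => r V hV.
      exact: (ch r _ hV).
right; exists 1; first by rewrite /= in_itv /= lexx ler01.
by rewrite /h mul1r addrC subrK.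
Qed.
End OuterComponent.

(** * Cauchy integrals of rational functions *)

Section MainFormula.
Context {R : realType}.
Notation I := (`[0, 1]%classic : set R).
Implicit Types (P q : {fraction {poly C R}}) (g : R -> C R) (s z : C R).

Lemma derive1_rateval P z s : ratmap P (Some z) = Some s ->
  derive1 (rateval P) z = (fibre_poly P (Some s))^`().[z] / (ratden P).[z].
Proof.
move=> Pz; have [D0 _ NE] := ratmap_finite Pz.
by rewrite [LHS](derive1_ratio _ D0) NE mulfK.
Qed.

(** The left side is the denominator of [P] over the fibre polynomial, whose [n] roots are the
    distinct points [c i]; the residues D(c_i) / F'(c_i) are 1 / P'(c_i). *)
Lemma inv_rateval_expansion P n s (c : 'I_n -> C R) z : ratdeg P = n ->
  ratmap P None != Some s -> injective c ->
  (forall i, ratmap P (Some (c i)) = Some s) ->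
  ~~ ratpole P z -> rateval P z != s ->
  (rateval P z - s)^-1 =
    inv_at_infty P s + \sum_(i < n) (derive1 (rateval P) (c i))^-1 * (z - c i)^-1.
Proof.
move=> Pn Pinf ic Pc zP Pz; subst n.
have D0 : (ratden P).[z] != 0 by [].
have FE : (fibre_poly P (Some s)).[z] = (rateval P z - s) * (ratden P).[z].
  by rewrite mulrBl /rateval divfK// !hornerE.
have F0 : ~~ root (fibre_poly P (Some s)) z.
  by rewrite rootE FE mulf_neq0// subr_eq0.
have rF i : root (fibre_poly P (Some s)) (c i) by have [] := ratmap_finite (Pc i).
have := partial_fraction ic (size_fibre_poly Pinf) (size_ratden P) rF F0.
rewrite (lead_coef_fibre_poly Pinf) FE invfM mulrCA divff// mulr1 => ->.
congr (_ + _); apply: eq_bigr => i _.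
by rewrite (derive1_rateval (Pc i)) invf_div.
Qed.

Lemma curve_integral_inv g (L1 L2 : C R -> C R) c : piecewise_smooth g ->
  log_branch_at L1 (g 0 - c) ->
  continuation_along g (fun z => L1 (z - c)) (fun z => L2 (z - c)) ->
  curve_integral g (fun z => (z - c)^-1) = L2 (g 1 - c) - L1 (g 0 - c).
Proof.
move=> sg lL1 cL.
have [phi [cphi ephi <- <-]] := log_along_curve (proj1 sg) lL1 cL.
exact: curve_integral_log.
Qed.

(* If c is a pole of q, the junk value rateval q c cancels between the terms. *)
Lemma curve_integral_cauchy q g c : piecewise_smooth g ->
  (forall r, r \in `[0, 1] -> ~~ ratpole q (g r)) ->
  (forall r, r \in `[0, 1] -> g r != c) ->
  curve_integral g (fun z => rateval q z * (z - c)^-1) =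
    qhat q g c + rateval q c * curve_integral g (fun z => (z - c)^-1).
Proof.
move=> sg qg gc.
have cq := within_continuous_rateval (proj1 sg) qg.
have ci : {within I, continuous ((fun z => (z - c)^-1) \o g)}.
  exact: (within_continuous_inv_sub (proj1 sg) gc).
have cq' : {within I, continuous ((fun z => rateval q z - rateval q c) \o g)}.
  exact (@within_continuousD R (C R) (C R) I (rateval q \o g)
    (fun=> - rateval q c) cq (@within_continuous_cst _ (- rateval q c))).
pose f1 z := (rateval q z - rateval q c) * (z - c)^-1.
pose f2 z := rateval q c * (z - c)^-1.
have c1 : {within I, continuous (f1 \o g)} by exact (@within_continuousM _ _ _ cq' ci).
have c2 : {within I, continuous (f2 \o g)}.
  exact (@within_continuousM _ _ _ (@within_continuous_cst _ (rateval q c)) ci).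
have := curve_integralZ (rateval q c) sg ci => <-.
transitivity (curve_integral g (fun z => f1 z + f2 z)).
  by apply: eq_curve_integral => r _; rewrite /f1 /f2 -mulrDl subrK.
exact: (curve_integralD sg c1 c2).
Qed.

Lemma curve_integral_rateval P q n g s (c : 'I_n -> C R) : piecewise_smooth g ->
  (forall r, r \in `[0, 1] -> ~~ ratpole P (g r)) ->
  (forall r, r \in `[0, 1] -> ~~ ratpole q (g r)) ->
  (forall r, r \in `[0, 1] -> rateval P (g r) != s) ->
  ratdeg P = n -> ratmap P None != Some s -> injective c ->
  (forall i, ratmap P (Some (c i)) = Some s) ->
  curve_integral g (fun z => rateval q z / (rateval P z - s)) =
  inv_at_infty P s * curve_integral g (rateval q) +
  \sum_(i < n) (derive1 (rateval P) (c i))^-1 *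
    (qhat q g (c i) + rateval q (c i) * curve_integral g (fun z => (z - c i)^-1)).
Proof.
move=> sg Pg qg gs Pn Pinf ic Pc.
(* The curve avoids the fibre over [s] because its image under [P] avoids [s]. *)
have gc i r : r \in `[0, 1] -> g r != c i.
  move=> rI; apply: contraNneq (gs r rI) => grc.
  by have := Pc i; rewrite -grc /= (negbTE (Pg r rI)) => -[->].
have cq := within_continuous_rateval (proj1 sg) qg.
have ci i : {within I, continuous ((fun z => rateval q z * (z - c i)^-1) \o g)}.
  exact (@within_continuousM _ _ _ cq (within_continuous_inv_sub (proj1 sg) (gc i))).
have cs : {within I, continuous ((fun z => \sum_(i < n)
    (derive1 (rateval P) (c i))^-1 * (rateval q z * (z - c i)^-1)) \o g)}.
  apply: within_continuous_sum => i.
  exact (@within_continuousM _ _ _ (@within_continuous_cst _ _) (ci i)).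
transitivity (curve_integral g (fun z => inv_at_infty P s * rateval q z +
    \sum_(i < n) (derive1 (rateval P) (c i))^-1 * (rateval q z * (z - c i)^-1))).
  apply: eq_curve_integral => r rI.
  rewrite (inv_rateval_expansion Pn Pinf ic Pc (Pg r rI) (gs r rI)) mulrDr mulrC.
  by congr (_ + _); rewrite mulr_sumr; apply: eq_bigr => i _; rewrite mulrCA.
have ck : {within I, continuous ((fun z => inv_at_infty P s * rateval q z) \o g)}.
  exact (@within_continuousM _ _ _ (@within_continuous_cst _ (inv_at_infty P s)) cq).
rewrite (curve_integralD sg ck cs) (curve_integralZ _ sg cq).
rewrite (curve_integral_sum _ _ sg ci); congr (_ + _); apply: eq_bigr => i _.
by rewrite (curve_integral_cauchy sg qg (gc i)).
Qed.

End MainFormula.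

Theorem theorem2p4 (R : realType) (P q : {fraction {poly C R}}) (n : nat)
    (g : R -> C R) (U : set (C R)) (B : 'I_n -> C R -> CP1 R) :
  (forall c : C R, P != tofrac c%:P) -> ratdeg P = n -> q != 0 ->
  curve g -> g 0 <> g 1 ->
  (forall z, trace g z -> ~~ ratpole P z /\ ~~ ratpole q z) ->
  simply_connected_domain U -> (Some @` U) `&` branch_points P = set0 ->
  boundary (Some @` U : set (CP1 R)) None ->
  inverse_branches P U B ->
  exists M : R, forall (L1 L2 : 'I_n -> C R -> C R -> C R),
    log_choice P g U B L1 L2 ->
    forall t : C R, U t -> U_infty P g (Some t) -> M%:C < `|t| ->
    \forall s \near t,
      I_infty P q g s =
        (two_pi_i R)^-1 * inv_at_infty P s * curve_integral g (rateval q)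
        + (two_pi_i R)^-1 *
          \sum_(i < n) (let c := finpart (B i s) in
             qhat q g c / derive1 (rateval P) c)
        + (two_pi_i R)^-1 *
          \sum_(i < n) (let c := finpart (B i s) in
             rateval q c / derive1 (rateval P) c *
             (L2 i s (g 1 - c) - L1 i s (g 0 - c))).
Proof.
move=> _ Pn _ [sg _] _ poles [oU _ cU _] U0 _ brB.
have trg r : r \in `[0, 1] -> trace g (g r) by exists r.
have Pg r : r \in `[0, 1] -> ~~ ratpole P (g r) by move=> /trg/poles[].
have qg r : r \in `[0, 1] -> ~~ ratpole q (g r) by move=> /trg/poles[].
(* Close to infinity means beyond |P(infinity)| when that value is finite, which ensures that [t]
   differs from it. [complex.Re] only turns the [C R]-valued norm into a real. *)
exists (if ratmap P None is Some c then complex.Re `|c| else 0) => L1 L2 logL t Ut Uit Mt.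
have Pinf : ratmap P None != Some t.
  apply/eqP => Pt; move: Mt; rewrite Pt (RRe_real (normr_real t)).
  by rewrite ltxx.
have nU : nbhs t U by exact: open_nbhs_nbhs.
have nI := U_infty_near (proj1 sg) Pg Uit.
have nP : \forall s \near t, ratmap P None != Some s.
  case: (ratmap P None) Pinf => [c|_]; last by apply: (nearW (F := nbhs t)).
  move=> ct; have ct' : c != t by [].
  exact: (@near_neq (C R) _ (nbhs t) _ (fun=> c) id c t (cvg_cst c) cvg_id ct').
apply: (filterS3 (F := nbhs t)) nU nI nP => s Us Uis Ps.
have [_ PB _] := brB.
(* A branch through infinity at [s] would force [s] to be P(infinity), so [finpart] returns genuine
   values here. *)
have BE i : B i s = Some (finpart (B i s)).
  have := PB i s Us; case: (B i s) => [//|Pinfs].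
  by move: Ps; rewrite Pinfs eqxx.
pose c i := finpart (B i s).
have ic : injective c.
  move=> i j cij; apply: (inverse_branches_distinct Pn oU cU U0 brB Us).
  by rewrite BE [RHS]BE; congr Some.
have Pc i : ratmap P (Some (c i)) = Some s by rewrite /c -BE; exact: PB.
have gs r : r \in `[0, 1] -> rateval P (g r) != s.
  move=> rI; apply/eqP => Pgs; apply: (connected_component_sub Uis).
  exists (Some (g r)); first by exists (g r) => //; exact: trg.
  by rewrite /= (negbTE (Pg r rI)) Pgs.
rewrite /I_infty (curve_integral_rateval sg Pg qg gs Pn Ps ic Pc).
(* The common factor is pulled out and the two sums of the formula are merged, leaving a comparison
   index by index. *)
rewrite -mulrA -!mulrDr -addrA -big_split /=; congr (_ * (_ + _)).
apply: eq_bigr => i _.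
have [lL1 cL] := logL i s (c i) Us Uis (BE i).
rewrite (curve_integral_inv sg lL1 cL) mulrDr mulrC; congr (_ + _).
by rewrite mulrA [_^-1 * _]mulrC.
Qed.
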